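(* The following three statements hold. (1) (DPS hierarchy.) Let $n\ge1$ and let $\rho\in\mathcal{H}^n\otimes\mathcal{H}^n$ be a bipartite state in the relative interior of the cone of separable states, $\rho\in\mathrm{relint}(\mathrm{SEP})$. Let $X=\mathbb{S}^{n-1}_{\mathbb{C}}\times\mathbb{S}^{n-1}_{\mathbb{C}}$. Then the supremum in $$\sup_{\Lambda\in\mathcal{H}^n\otimes\mathcal{H}^n}\{\mathrm{Trace}(\rho\Lambda)\ :\ 1-(x\otimes y)^*\Lambda(x\otimes y)\ge 0\text{ for all }(x,y)\in X\}$$ is attained, and for every integer $t\ge 2$ the supremum in $$\sup_{\Lambda\in\mathcal{H}^n\otimes\mathcal{H}^n}\{\mathrm{Trace}(\rho\Lambda)\ :\ 1-(x\otimes y)^*\Lambda(x\otimes y)\in\Sigma_{2t}+\langle\varphi_1,\varphi_2\rangle_{2t}\}$$ is attained. (2) (Order 2 quantum Wasserstein distance.) Let $n\ge 1$ and let $\tau,\omega\in\mathcal{D}(\mathbb{C}^n)$ be in the relative interior of $\mathcal{D}(\mathbb{C}^n)$, i.e. positive definite. Let $X=\mathbb{S}^{n-1}_{\mathbb{C}}\times\mathbb{S}^{n-1}_{\mathbb{C}}$ and $f(x,\overline{x},y,\overline{y})=\mathrm{Trace}\big((xx^*-yy^* )\overline{(xx^*-yy^* )}\big)$. Then the supremum in $$\sup_{\Lambda,\Gamma\in\mathcal{H}^n}\{\mathrm{Trace}(\tau\Lambda+\omega\Gamma)\ :\ f-x^*\Lambda x-y^*\Gamma y\ge 0\text{ on }X\}$$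 is attained, and for every integer $t\ge 2$ the supremum in $$\sup_{\Lambda,\Gamma\in\mathcal{H}^n}\{\mathrm{Trace}(\tau\Lambda+\omega\Gamma)\ :\ f-x^*\Lambda x-y^*\Gamma y\in\Sigma_{2t}+\langle\varphi_1,\varphi_2\rangle_{2t}\}$$ is attained. (3) (Best rank one approximation.) Let $a\ge 1$, $n_1,\dots,n_a\ge 2$, and $\mathcal{A}\in\mathbb{R}^{n_1\times\dots\times n_a}$. Let $X=\mathbb{S}^{n_1-1}\times\dots\times\mathbb{S}^{n_a-1}$ be the product of real unit spheres and $\mathcal{A}(x)=\sum_{j_1=1}^{n_1}\cdots\sum_{j_a=1}^{n_a}\mathcal{A}_{j_1\dots j_a}x_{1j_1}\cdots x_{aj_a}$. Then the supremum in $$\sup_{\lambda\in\mathbb{R}}\{\lambda\ :\ \mathcal{A}(x)-\lambda\ge0\text{ on }X\}$$ is attained, and for every integer $t\ge\max\{1,\lceil\deg(\mathcal{A}(x))/2\rceil\}$ the supremum in $$\sup_{\lambda\in\mathbb{R}}\{\lambda\ :\ \mathcal{A}(x)-\lambda\in\Sigma[x]_{2t}+\langle\psi_1,\dots,\psi_a\rangle_{2t}\},\qquad \psi_l=1-\|x_l\|^2,$$ is attained.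
   Context: $\mathcal{H}^n$ is the real vector space of $n\times n$ complex Hermitian matrices. $\mathcal{D}(\mathbb{C}^n)\subset\mathcal{H}^n$ is the set of positive semidefinite matrices with trace one. The cone of separable bipartite states is $$\mathrm{SEP}=\mathrm{cone}\Big\{\rho\in\mathcal{H}^n\otimes\mathcal{H}^n\ \Big|\ \rho=\sum_{\ell=1}^r w_\ell\, x^{(\ell)}{x^{(\ell)}}^*\otimes y^{(\ell)}{y^{(\ell)}}^*,\ w_\ell\ge0,\ x^{(\ell)},y^{(\ell)}\in\mathbb{C}^n,\ r\in\mathbb{N}\Big\}.$$ Relative interior means interior within the affine hull. $\mathbb{S}^{n-1}_{\mathbb{C}}=\{x\in\mathbb{C}^n\mid 1-\|x\|^2=0\}$; $x^*$ denotes conjugate transpose and an overline denotes entrywise complex conjugation. The first program in each item is the dual of a generalized moment problem over $X$, respectively: (1) $\inf\{\int_X 1\,d\mu:\int_X xx^*\otimes yy^*\,d\mu=\rho\}$; (2) $\inf\{\int_X f\,d\mu:\int_X xx^*\,d\mu=\tau,\ \int_X yy^*\,d\mu=\omega\}$; (3) $\inf\{\int_X\mathcal{A}(x)\,d\mu:\int_X 1\,d\mu=1\}$, where $\mu$ ranges over finite nonnegative Borel measures on $X$. The second program in each item is the order-$t$ sum-of-squares strengthening. In items (1) and (2), real-valued polynomials in $x,\overline{x},y,\overline{y}$ are regarded as real polynomials in the $4n$ real variables $(x_{\mathrm{Re}},x_{\mathrm{Im}},y_{\mathrm{Re}},y_{\mathrm{Im}})$ through $x=x_{\mathrm{Re}}+\mathbf{i}x_{\mathrm{Im}}$,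 $y=y_{\mathrm{Re}}+\mathbf{i}y_{\mathrm{Im}}$ ($\mathbf{i}=\sqrt{-1}$); $\varphi_1=1-\|x_{\mathrm{Re}}\|^2-\|x_{\mathrm{Im}}\|^2$, $\varphi_2=1-\|y_{\mathrm{Re}}\|^2-\|y_{\mathrm{Im}}\|^2$; $\Sigma_{2t}$ is the set of sums of squares of real polynomials in these $4n$ variables having degree at most $2t$; and $\langle\varphi_1,\varphi_2\rangle_{2t}=\{k_1\varphi_1+k_2\varphi_2\mid\deg(k_l\varphi_l)\le2t\}$ with $k_1,k_2$ real polynomials in these variables. In item (3), $x=(x_1,\dots,x_a)$ with $x_l=(x_{l1},\dots,x_{ln_l})$, $\Sigma[x]_{2t}$ is the set of sums of squares of real polynomials in $x$ of degree at most $2t$, and $\langle\psi_1,\dots,\psi_a\rangle_{2t}=\{\sum_l k_l\psi_l\mid k_l\in\mathbb{R}[x],\ \deg(k_l\psi_l)\le 2t\}$. The degree of the zero polynomial is taken to be $0$ here. *)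

(* Defs.v *)
From HB Require Import structures.
From mathcomp Require Import all_boot all_order all_algebra.
From mathcomp Require Import complex mxtens mpoly.
From mathcomp Require Import boolp classical_sets reals.
(* The topology.v umbrella file cannot be imported together with mpoly: their
   notations clash. *)
From mathcomp Require Import filter num_topology matrix_topology.

Set Implicit Arguments.
Unset Strict Implicit.
Unset Printing Implicit Defensive.

Import Order.TTheory GRing.Theory Num.Theory.
Local Open Scope ring_scope.
Local Open Scope classical_set_scope.
Local Open Scope sesquilinear_scope.
Local Open Scope complex_scope.

Definition sup_attained (R : realType) (V : Type) (S : set V) (g : V -> R) :=
  exists2 v, S v & ubound (g @` S) (g v).

Section ConvexGeometry.
Context {R : realType} {m : nat}.
Implicit Types S : set 'M[R[i]]_m.

Definition cone_hull S : set 'M[R[i]]_m := [set M |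
  exists (r : nat) (w : 'I_r -> R) (s : 'I_r -> 'M[R[i]]_m),
    [/\ forall l, 0 <= w l, forall l, S (s l) & M = \sum_l (w l)%:C *: s l]].

Definition affine_hull S : set 'M[R[i]]_m := [set M |
  exists (r : nat) (w : 'I_r -> R) (s : 'I_r -> 'M[R[i]]_m),
    [/\ \sum_l w l = 1, forall l, S (s l) & M = \sum_l (w l)%:C *: s l]].

(* [R[i]^o] is the copy of [R[i]] that carries the topology of the norm. *)
Definition relint S : set 'M[R[i]]_m := [set M |
  affine_hull S M /\
  within (affine_hull S) (nbhs (M : 'M[R[i]^o]_m)) S].

End ConvexGeometry.

Section States.
Variables (R : realType) (n : nat).

Definition herm : set 'M[R[i]]_n := [set M | M \is hermsymmx].

Definition density : set 'M[R[i]]_n := [set M |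
  [/\ herm M, forall v : 'cV[R[i]]_n, 0 <= \tr (v ^t* *m M *m v)
    & \tr M = 1]].

(* Tensor product over the reals; [*t] is the Kronecker product. *)
Definition herm_tensor : set 'M[R[i]]_(n * n) := [set M |
  exists (r : nat) (A B : 'I_r -> 'M[R[i]]_n),
    [/\ forall l, herm (A l), forall l, herm (B l) & M = \sum_l A l *t B l]].

Definition SEP : set 'M[R[i]]_(n * n) := cone_hull [set rho |
  herm_tensor rho /\
  exists (r : nat) (w : 'I_r -> R) (x y : 'I_r -> 'cV[R[i]]_n),
    (forall l, 0 <= w l) /\
    rho = \sum_l (w l)%:C *: ((x l *m x l ^t*) *t (y l *m y l ^t*))].

Definition csphere : set 'cV[R[i]]_n :=
  [set x | 1 - \sum_j `|x j 0| ^+ 2 = 0].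

Definition rsphere : set 'cV[R]_n := [set x | 1 - \sum_j x j 0 ^+ 2 = 0].

End States.

Arguments density : clear implicits.
Arguments SEP : clear implicits.

Section Truncated.
Context {R : realType} {N : nat}.
Implicit Types p : {mpoly R[N]}.

(* [msize] is one plus the degree, and [msize 0 = 0]: here [deg 0 = 0]. *)
Definition deg p : nat := (msize p).-1.

Definition sos (d : nat) : set {mpoly R[N]} := [set p |
  (deg p <= d)%N /\ exists s : seq {mpoly R[N]}, p = \sum_(q <- s) q ^+ 2].

Definition trunc_ideal (m : nat) (phi : 'I_m -> {mpoly R[N]}) (d : nat) :
    set {mpoly R[N]} := [set p |
  exists k : 'I_m -> {mpoly R[N]},
    (forall l, (deg (k l * phi l) <= d)%N) /\ p = \sum_l k l * phi l].

Definition sos_plus_ideal (m : nat) (phi : 'I_m -> {mpoly R[N]}) (d : nat) :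
    set {mpoly R[N]} := [set p |
  exists s h, [/\ sos d s, trunc_ideal phi d h & p = s + h]].

End Truncated.

(* The forms below take a vector and its conjugate as separate arguments, so
   that they can be evaluated both at complex vectors and at vectors of
   polynomials. *)
Section Forms.
Context {K : comNzRingType} {n : nat}.
Implicit Types x xb y yb : 'cV[K]_n.

(* x^* L x *)
Definition qform (L : 'M[K]_n) x xb : K := \tr (xb^T *m L *m x).

(* (x (x) y)^* L (x (x) y) *)
Definition tensor_qform (L : 'M[K]_(n * n)) x xb y yb : K :=
  \tr ((xb *t yb)^T *m L *m (x *t y)).

(* Trace ((x x^* - y y^* ) conj (x x^* - y y^* )) *)
Definition wasserstein_cost x xb y yb : K :=
  \tr ((x *m xb^T - y *m yb^T) *m (xb *m x^T - yb *m y^T)).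

End Forms.

Section ComplexVariables.
Variables (R : realType) (n : nat).

(* The [4 * n] real variables come in the four blocks xRe, xIm, yRe, yIm. *)
Definition rvar (A : nzRingType) (k : 'I_4) (j : 'I_n) : {mpoly A[4 * n]} :=
  'X_(mxvec_index k j).

Definition cvar (re im : 'I_4) : 'cV[{mpoly R[i][4 * n]}]_n :=
  \col_j (rvar _ re j + ('i%C)%:MP * rvar _ im j).

Definition cvarb (re im : 'I_4) : 'cV[{mpoly R[i][4 * n]}]_n :=
  \col_j (rvar _ re j - ('i%C)%:MP * rvar _ im j).

Definition px := cvar 0 1.
Definition pxb := cvarb 0 1.
Definition py := cvar 2 3.
Definition pyb := cvarb 2 3.

Definition sphere_poly (re im : 'I_4) : {mpoly R[4 * n]} :=
  1 - \sum_j rvar R re j ^+ 2 - \sum_j rvar R im j ^+ 2.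

Definition bisphere_polys : 'I_2 -> {mpoly R[4 * n]} :=
  tnth [tuple sphere_poly 0 1; sphere_poly 2 3].

(* A polynomial with complex coefficients counts as a member when it is a
   polynomial with real coefficients belonging to the real set. *)
Definition bisphere_sos (t : nat) : set {mpoly R[i][4 * n]} :=
  map_mpoly (real_complex R) @` sos_plus_ideal bisphere_polys (2 * t).

End ComplexVariables.

Section Tensors.
Context {R : realType} {a : nat} (dim : 'I_a -> nat).

Definition multi_index := {dffun forall l : 'I_a, 'I_(dim l)}.

Definition tensor_form (K : comNzRingType) (A : multi_index -> K)
    (x : forall l : 'I_a, 'cV[K]_(dim l)) : K :=
  \sum_(j : multi_index) A j * \prod_l x l (j l) 0.

Definition tensor_var (l : 'I_a) :
    'cV[{mpoly R[\sum_(k < a) dim k]}]_(dim l) :=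
  \col_j 'X_(tagnat.Rank l j).

Definition tensor_poly (A : multi_index -> R) :
    {mpoly R[\sum_(k < a) dim k]} :=
  tensor_form (fun j => (A j)%:MP) tensor_var.

Definition multisphere_polys (l : 'I_a) : {mpoly R[\sum_(k < a) dim k]} :=
  1 - \sum_j tensor_var l j 0 ^+ 2.

End Tensors.

(* Main.v *)
(* In all three items the objective is, up to a constant, minus a nonnegative
   combination of the values of the constrained polynomial p at points of X, and
   X is a product of spheres. The relative interior hypotheses bound p(z) at
   every z in X once p >= 0 on X and the objective is bounded below: every state
   v can be written as a positive multiple of the difference of the given state
   and another state. Polynomials of bounded degree are determined on X by their
   values at finitely many points of X, so each program becomes the optimization
   of a linear functional over a bounded subset of some R^K.

   This subset is closed also in the sum-of-squares case. A polynomial of degree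
   at most d that vanishes on X lies in the truncated ideal of degree d, hence
   membership only concerns the values on X; by Caratheodory K squares suffice,
   and their values are bounded by those of p. No normalization of the dual
   variables is needed, since only the values of p enter. *)

Require Import Defs.
From mathcomp Require Import all_boot all_order all_algebra.
From mathcomp Require Import complex mxtens mpoly ring lra zify.
From mathcomp Require Import boolp classical_sets reals.
From mathcomp Require Import num_topology matrix_topology.
From mathcomp Require Import topology_structure pseudometric_structure.
From mathcomp Require Import compact subspace_topology function_spaces.
From mathcomp Require Import pseudometric_normed_Zmodule num_normedtype.
From mathcomp Require Import normed_module derive.

Set Implicit Arguments.
Unset Strict Implicit.
Unset Printing Implicit Defensive.

Import Order.TTheory GRing.Theory Num.Theory.
Import numFieldNormedType.Exports.
Local Open Scope ring_scope.
Local Open Scope classical_set_scope.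

(** * Sums of squares of vectors *)

(** The truncated ideal statement keeps the degree because one coordinate [hd l] is singled out on
    each sphere and its square is rewritten, modulo [sph l], as one minus the other squares, which
    never raises the degree. A polynomial with exponent at most one in every [hd l] that vanishes on
    X is zero, so nothing is left after the reduction. The values of sums of squares form a
    projection of a set, for which closedness is not automatic. The values of the squared
    polynomials are therefore kept as additional coordinates: the lifted set is cut out by
    polynomial conditions inside a box, hence compact. Each squared polynomial may be taken from the
    fixed space of degree at most t, because leading terms of real squares do not cancel. The
    truncated programs are feasible because a large enough constant plus a polynomial of degree at
    most 2t is a truncated sum of squares modulo the ideal. The forms of items (1) and (2) have
    degree at most four, whence the bound 2 on t. *)

Lemma finite_span (F : fieldType) (D : nat) (Y : set 'rV[F]_D) :
  exists K (M : 'M[F]_(K, D)),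
    (forall i, Y (row i M)) /\ forall y, Y y -> (y <= M)%MS.
Proof.
pose P k := `[< exists K (M : 'M[F]_(K, D)),
  (forall i, Y (row i M)) /\ \rank M = k >].
have exP : exists k, P k.
  exists 0%N; apply/asboolP; exists 0%N, 0; split; first by case.
  by rewrite mxrank0.
have ubP k : P k -> (k <= D)%N.
  by move=> /asboolP[K [M [_ <-]]]; exact: rank_leq_col.
(* Among all families in [Y], one of maximal rank is chosen; adjoining any [y] of [Y] cannot raise
   the rank, so [y] already lies in the row space. *)
case: (ex_maxnP exP ubP) => k /asboolP[K [M [YM rM]]] kmax.
exists K, M; split=> // y Yy.
have ler : (\rank (col_mx M y) <= k)%N.
  apply: kmax; apply/asboolP; exists (K + 1)%N, (col_mx M y); split=> // i.
  rewrite -(splitK i); case: (split i) => j /=.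
    by rewrite rowKu.
  by rewrite rowKd (ord1 j) row_id.
have sub : (M <= col_mx M y)%MS by rewrite -addsmxE addsmxSl.
have : (col_mx M y <= M)%MS.
  by rewrite -(geq_leqif (mxrank_leqif_sup sub)) rM.
by apply: submx_trans; rewrite -addsmxE addsmxSr.
Qed.

Section Squares.
Variables (R : realType) (K : nat).

Definition row_sqr (u : 'rV[R]_K) : 'rV[R]_K := \row_k u 0 k ^+ 2.

Lemma row_sqr0 : row_sqr 0 = 0.
Proof. by apply/rowP => k; rewrite !mxE expr0n. Qed.

Lemma row_sqr_sqrtZ (c : R) u : 0 <= c -> row_sqr (Num.sqrt c *: u) = c *: row_sqr u.
Proof. by move=> c0; apply/rowP => k; rewrite !mxE exprMn sqr_sqrtr. Qed.

(** The elimination step of Caratheodory: more than [K] rows of squares satisfy a linear relation,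
    and subtracting a suitable multiple of it removes one term while the other coefficients stay
    nonnegative. Their square roots are absorbed by the scaling of [U]. *)
Lemma sum_row_sqr_reduce (U : set 'rV[R]_K) m (u : 'I_m.+1 -> 'rV[R]_K) :
  (forall c v, U v -> U (c *: v)) -> (K < m.+1)%N -> (forall i, U (u i)) ->
  exists u' : 'I_m -> 'rV[R]_K,
    (forall i, U (u' i)) /\ \sum_i row_sqr (u i) = \sum_i row_sqr (u' i).
Proof.
move=> UZ Km Uu; pose M := \matrix_i row_sqr (u i).
have : kermx M != 0.
  rewrite kermx_eq0 /row_free; apply/eqP => rM.
  by have := rank_leq_col M; rewrite rM leqNgt Km.
move=> /rowV0Pn[v0 /sub_kermxP v0M /rV0Pn[i1 v0i1]].
(* The sign of the relation is free; one positive entry makes its maximum positive. *)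
have [v vM vi1] : exists2 v : 'rV[R]_m.+1, v *m M = 0 & 0 < v 0 i1.
  move: v0i1; rewrite neq_lt => /orP[lt0|gt0]; last by exists v0.
  by exists (- v0); rewrite ?mulNmx ?v0M ?oppr0// mxE oppr_gt0.
pose i0 := [arg max_(i > i1) v 0 i]%O.
have vle i : v 0 i <= v 0 i0.
  by rewrite /i0; case: Order.TotalTheory.arg_maxP => // j _ /(_ i); exact.
have v0gt : 0 < v 0 i0 by exact: lt_le_trans (vle i1).
(* Dividing by the largest entry gives coefficients that are nonnegative everywhere, also where [v]
   is negative, and zero at [i0]. *)
pose c i := 1 - v 0 i / v 0 i0.
have c0 i : 0 <= c i by rewrite subr_ge0 ler_pdivrMr// mul1r.
have sumv : \sum_i v 0 i *: row_sqr (u i) = 0.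
  move: vM; rewrite mulmx_sum_row; apply: etrans.
  by apply: eq_bigr => i _; rewrite rowK.
exists (fun i => Num.sqrt (c (lift i0 i)) *: u (lift i0 i)); split=> [i|].
  exact/UZ/Uu.
transitivity (\sum_i c i *: row_sqr (u i)).
  rewrite [RHS](eq_bigr (fun i => row_sqr (u i) - (v 0 i0)^-1 *: (v 0 i *: row_sqr (u i)))).
    by rewrite sumrB -scaler_sumr sumv scaler0 subr0.
  by move=> i _; rewrite /c scalerBl scale1r scalerA mulrC.
rewrite (bigD1_ord i0)//= {1}/c divff ?gt_eqF// subrr scale0r add0r.
by apply: eq_bigr => i _; rewrite row_sqr_sqrtZ.
Qed.

(* Caratheodory: the squares live in a space of dimension [K]. *)
Lemma sum_row_sqr_bounded (U : set 'rV[R]_K) m (u : 'I_m -> 'rV[R]_K) :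
  U 0 -> (forall c v, U v -> U (c *: v)) -> (forall i, U (u i)) ->
  exists u' : 'I_K -> 'rV[R]_K,
    (forall i, U (u' i)) /\ \sum_i row_sqr (u i) = \sum_i row_sqr (u' i).
Proof.
move=> U0 UZ; elim: m u => [|m IH] u Uu.
  exists (fun=> 0); split=> //; rewrite big_ord0 big1// => i _.
  exact: row_sqr0.
have [Km|mK] := ltnP K m.+1.
  have [u1 [Uu1 ->]] := sum_row_sqr_reduce UZ Km Uu.
  by have [u' [Uu' ->]] := IH _ Uu1; exists u'.
(* Fewer than [K] squares are padded: [insub] fails from index [m.+1] on, and there the vector is
   zero. *)
exists (fun i => oapp u 0 (insub (val i))); split=> [i|].
  by case: insubP => [j _ _|_] /=.
pose G (k : nat) := row_sqr (oapp u 0 (insub k)).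
rewrite (eq_bigr (fun i : 'I_m.+1 => G i)); last by move=> i _; rewrite /G valK.
rewrite (big_ord_widen K G mK) big_mkcond; apply: eq_bigr => i _.
by case: ltnP => // h; rewrite insubN -?leqNgt//= row_sqr0.
Qed.

End Squares.

(** * Minimization over bounded polynomially closed sets *)

Section Compactness.
Variables (R : realType) (I : choiceType).

(** A syntactic class, so that continuity for the pointwise topology follows by induction on the
    expression. *)
Inductive polyfun : ((I -> R) -> R) -> Prop :=
| polyfun_cst c : polyfun (fun=> c)
| polyfun_proj i : polyfun (fun u => u i)
| polyfunD f g : polyfun f -> polyfun g -> polyfun (fun u => f u + g u)
| polyfunM f g : polyfun f -> polyfun g -> polyfun (fun u => f u * g u).

Lemma polyfun_sum (J : Type) (r : seq J) (f : J -> (I -> R) -> R) :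
  (forall j, polyfun (f j)) -> polyfun (fun u => \sum_(j <- r) f j u).
Proof.
move=> pf; elim: r => [|j r IH].
  by under eq_fun do rewrite big_nil; exact: polyfun_cst.
by under eq_fun do rewrite big_cons; exact: polyfunD.
Qed.

Lemma polyfun_continuous (f : {ptws I -> R} -> R) : polyfun f -> continuous f.
Proof.
elim=> [c|i|g h _ cg _ ch|g h _ cg _ ch] u.
- exact: cst_continuous.
- exact: (@proj_continuous I (fun=> R)).
- exact: (@cvgD _ _ {ptws I -> R} _ _ g h _ _ (cg u) (ch u)).
- exact: (@cvgM _ {ptws I -> R} _ _ g h _ _ (cg u) (ch u)).
Qed.

(** The index type [J] is arbitrary: nonnegativity at every point of X is an infinite family of
    conditions. *)
Inductive polyclosed : set (I -> R) -> Prop :=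
| polyclosed_ge0 f : polyfun f -> polyclosed [set u | 0 <= f u]
| polyclosed_forall (J : Type) (Z : J -> set (I -> R)) :
    (forall j, polyclosed (Z j)) -> polyclosed [set u | forall j, Z j u].

Lemma polyclosedI Z1 Z2 : polyclosed Z1 -> polyclosed Z2 -> polyclosed (Z1 `&` Z2).
Proof.
move=> c1 c2; pose Z b := if b then Z1 else Z2.
rewrite (_ : Z1 `&` Z2 = [set u | forall b, Z b u]).
  by apply: polyclosed_forall => -[].
apply/seteqP; split=> [u [Z1u Z2u] []//|u Zu].
by split; [exact: (Zu true)|exact: (Zu false)].
Qed.

Lemma polyclosed_le f g : polyfun f -> polyfun g -> polyclosed [set u | f u <= g u].
Proof.
move=> pf pg; rewrite (_ : mkset _ = [set u | 0 <= g u + -1 * f u]).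
  by apply/polyclosed_ge0/polyfunD => //; apply: polyfunM => //; exact: polyfun_cst.
by apply/funext => u /=; rewrite mulN1r subr_ge0.
Qed.

Lemma polyclosed_eq f g : polyfun f -> polyfun g -> polyclosed [set u | f u = g u].
Proof.
move=> pf pg; rewrite (_ : mkset _ = [set u | f u <= g u] `&` [set u | g u <= f u]).
  by apply: polyclosedI; exact: polyclosed_le.
apply/seteqP; split=> u /= => [->|[fg gf]]; first by rewrite lexx.
by apply/eqP; rewrite eq_le fg.
Qed.

Lemma polyclosed_closed Z : polyclosed Z -> closed (Z : set {ptws I -> R}).
Proof.
elim=> [f pf|J {}Z _ cZ].
  apply: (@preimage_closed {ptws I -> R} R f [set x | 0 <= x]).
    by move=> u _; exact: polyfun_continuous.
  exact: closed_ge.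
rewrite (_ : mkset _ = \bigcap_j Z j); first by apply: closed_bigI => j _; exact: cZ.
by apply/seteqP; split=> u /= Zu j *; exact: Zu.
Qed.

(** A product of segments is compact by Tychonoff, so a closed part of it is compact and a
    continuous function attains its minimum there. *)
Lemma polyfun_min (g : (I -> R) -> R) (Z : set (I -> R)) (a b : I -> R) :
  polyfun g -> polyclosed Z ->
  (forall u, Z u -> forall i, a i <= u i <= b i) ->
  Z !=set0 -> exists2 u, Z u & forall v, Z v -> g u <= g v.
Proof.
move=> pg pZ Zb Z0.
have cZ : @compact {ptws I -> R} Z.
  apply: (@subclosed_compact {ptws I -> R} Z
    [set f : {ptws I -> R} | forall i, `[a i, b i]%classic (f i)]).
  - exact: polyclosed_closed.
  - apply: (@tychonoff I (fun=> R) (fun i => `[a i, b i]%classic)) => i.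
    exact: segment_compact.
  - by move=> u Zu i /=; rewrite in_itv/=; exact: Zb.
have [u Zu umin] := @compact_EVT_min {ptws I -> R} R g Z Z0 cZ
  (@continuous_subspaceT {ptws I -> R} R Z g (polyfun_continuous pg)).
exists u => [|v Zv]; first by rewrite inE in Zu.
by apply: umin; rewrite inE.
Qed.

End Compactness.

(** * Degrees and truncated ideals *)

Section Degree.
Variables (N : nat) (A : nzRingType).
Implicit Types p q : {mpoly A[N]}.

Lemma msizeD_leq k p q :
  (msize p <= k)%N -> (msize q <= k)%N -> (msize (p + q) <= k)%N.
Proof. by move=> pk qk; apply: leq_trans (msizeD_le _ _) _; rewrite geq_max pk. Qed.

Lemma msizeB_leq k p q :
  (msize p <= k)%N -> (msize q <= k)%N -> (msize (p - q) <= k)%N.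
Proof. by move=> pk qk; apply: msizeD_leq => //; rewrite msizeN. Qed.

Lemma msize_sum_leq (I : Type) (r : seq I) (P : pred I) (F : I -> {mpoly A[N]}) k :
  (forall i, P i -> (msize (F i) <= k)%N) -> (msize (\sum_(i <- r | P i) F i) <= k)%N.
Proof.
move=> Fk; elim/big_ind: _ => //; first by rewrite msize0.
by move=> p q; exact: msizeD_leq.
Qed.

Lemma msizeM_leq d e p q :
  (msize p <= d.+1)%N -> (msize q <= e.+1)%N -> (msize (p * q) <= (d + e).+1)%N.
Proof.
move=> pd qe; have [->|p0] := eqVneq p 0; first by rewrite mul0r msize0.
have [->|q0] := eqVneq q 0; first by rewrite mulr0 msize0.
have [->|pq0] := eqVneq (p * q) 0; first by rewrite msize0.
rewrite -mlead_deg// ltnS; apply: leq_trans (lemc_mdeg (mleadM_le p q)) _.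
by rewrite mdegD leq_add// -ltnS mlead_deg.
Qed.

Lemma msizeC_leq d (c : A) : (msize (c%:MP : {mpoly A[N]}) <= d.+1)%N.
Proof. by rewrite msizeC; case: (c == 0). Qed.

Lemma msizeZ_leq k c p : (msize p <= k)%N -> (msize (c *: p) <= k)%N.
Proof. exact/leq_trans/msizeZ_le. Qed.

Lemma msizeXU_leq (i : 'I_N) : (msize ('X_i : {mpoly A[N]}) <= 2)%N.
Proof. by rewrite msizeX mdeg1. Qed.

End Degree.

(** The equality also covers the zero polynomial, for which [deg] and [msize] are both 0. *)
Lemma deg_leE (R : realType) (N : nat) (p : {mpoly R[N]}) d :
  (deg p <= d)%N = (msize p <= d.+1)%N.
Proof. by rewrite /deg; case: (msize p). Qed.

Section Truncation.
Variables (R : realType) (N m : nat) (phi : 'I_m -> {mpoly R[N]}).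
Implicit Types (p q : {mpoly R[N]}) (d : nat).

Lemma trunc_ideal0 d : trunc_ideal phi d 0.
Proof.
exists (fun=> 0); split; last by rewrite big1// => l _; rewrite mul0r.
by move=> l; rewrite mul0r deg_leE msize0.
Qed.

Lemma trunc_idealD d p q :
  trunc_ideal phi d p -> trunc_ideal phi d q -> trunc_ideal phi d (p + q).
Proof.
move=> [k [kd ->]] [k' [k'd ->]]; exists (fun l => k l + k' l); split=> [l|].
  by rewrite mulrDl deg_leE msizeD_leq -?deg_leE.
by rewrite -big_split; apply: eq_bigr => l _; rewrite mulrDl.
Qed.

Lemma trunc_idealZ d c p : trunc_ideal phi d p -> trunc_ideal phi d (c *: p).
Proof.
move=> [k [kd ->]]; exists (fun l => c *: k l); split=> [l|].
  by rewrite -scalerAl deg_leE msizeZ_leq -?deg_leE.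
by rewrite scaler_sumr; apply: eq_bigr => l _; rewrite scalerAl.
Qed.

Lemma trunc_ideal_gen d k l :
  (msize (k * phi l) <= d.+1)%N -> trunc_ideal phi d (k * phi l).
Proof.
move=> kd; exists (fun l' => if l' == l then k else 0); split=> [l'|].
  by rewrite deg_leE; case: eqP => [->//|_]; rewrite mul0r msize0.
rewrite (bigD1 l)//= eqxx big1 ?addr0// => l' /negbTE ->.
by rewrite mul0r.
Qed.

Lemma trunc_ideal_meval d p z :
  trunc_ideal phi d p -> (forall l, (phi l).@[z] = 0) -> p.@[z] = 0.
Proof.
move=> [k [_ ->]] z0; rewrite raddf_sum big1// => l _ /=.
by rewrite mevalM z0 mulr0.
Qed.

Let Q d := sos_plus_ideal phi d.

Lemma sos_plus_idealD d p q : Q d p -> Q d q -> Q d (p + q).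
Proof.
move=> [p1 [p2 [[dp [s sE]] ip ->]]] [q1 [q2 [[dq [r rE]] iq ->]]].
exists (\sum_(q <- s ++ r) q ^+ 2), (p2 + q2); split.
- split; last by exists (s ++ r).
  by rewrite big_cat/= -sE -rE deg_leE msizeD_leq -?deg_leE.
- exact: trunc_idealD.
- by rewrite big_cat/= -sE -rE addrACA.
Qed.

Lemma sos_plus_idealZ d c p : 0 <= c -> Q d p -> Q d (c *: p).
Proof.
move=> c0 [p1 [p2 [[dp [s sE]] ip ->]]].
exists (c *: p1), (c *: p2); split; last by rewrite scalerDr.
- split; first by rewrite deg_leE msizeZ_leq -?deg_leE.
  exists [seq Num.sqrt c *: q | q <- s]; rewrite big_map sE scaler_sumr.
  by apply: eq_bigr => q _; rewrite exprZn sqr_sqrtr.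
- exact: trunc_idealZ.
Qed.

Lemma sos_plus_ideal_ideal d p : trunc_ideal phi d p -> Q d p.
Proof.
move=> ip; exists 0, p; split => //; last by rewrite add0r.
by split; [rewrite deg_leE msize0|exists [::]; rewrite big_nil].
Qed.

Lemma sos_plus_ideal0 d : Q d 0.
Proof. exact/sos_plus_ideal_ideal/trunc_ideal0. Qed.

Lemma sos_plus_ideal_sum d (I : Type) (r : seq I) (P : pred I) (F : I -> {mpoly R[N]}) :
  (forall i, P i -> Q d (F i)) -> Q d (\sum_(i <- r | P i) F i).
Proof.
move=> QF; elim/big_ind: _ => //; first exact: sos_plus_ideal0.
by move=> p q; exact: sos_plus_idealD.
Qed.

Lemma sos_plus_ideal_sqr t q : (msize q <= t.+1)%N -> Q (2 * t) (q ^+ 2).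
Proof.
move=> qt; exists (q ^+ 2), 0; split; last by rewrite addr0.
- split; last by exists [:: q]; rewrite big_seq1.
  by rewrite deg_leE expr2 mul2n -addnn msizeM_leq.
- exact: trunc_ideal0.
Qed.

Lemma sos_plus_ideal_meval_ge0 d p z :
  Q d p -> (forall l, (phi l).@[z] = 0) -> 0 <= p.@[z].
Proof.
move=> [p1 [p2 [[_ [s ->]] ip ->]]] z0.
rewrite mevalD (trunc_ideal_meval ip z0) addr0 raddf_sum.
by apply: sumr_ge0 => q _ /=; rewrite rmorphXn sqr_ge0.
Qed.

End Truncation.

Lemma seq_max (T : eqType) d (O : orderType d) (f : T -> O) (s : seq T) x :
  x \in s -> exists2 y, y \in s & forall z, z \in s -> (f z <= f y)%O.
Proof.
elim: s x => // a [|b s] IH x _.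
  by exists a; rewrite ?mem_head// => z; rewrite inE => /eqP ->.
have [y ys ymax] := IH b (mem_head _ _).
have [ay|/ltW ya] := leP (f a) (f y).
  by exists y => [|z]; rewrite inE ?ys ?orbT// => /orP[/eqP ->|/ymax].
exists a => [|z]; first exact: mem_head.
by rewrite inE => /orP[/eqP ->//|/ymax zy]; exact: le_trans ya.
Qed.

(* The leading coefficients of squares cannot cancel. *)
Lemma msize_sum_sqr (R : realType) (N t : nat) (s : seq {mpoly R[N]}) q :
  (msize (\sum_(q <- s) q ^+ 2) <= (2 * t).+1)%N -> q \in s -> (msize q <= t.+1)%N.
Proof.
move=> st qs; have [q0 q0s q0max] := seq_max (@mlead _ _) qs.
suff q0t : (msize q0 <= t.+1)%N.
  have [->|q0n] := eqVneq q 0; first by rewrite msize0.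
  rewrite -mlead_deg// ltnS (leq_trans (lemc_mdeg (q0max _ qs)))//.
  have [->|q00] := eqVneq q0 0; first by rewrite mlead0 mdeg0.
  by rewrite -ltnS mlead_deg.
have [->|q00] := eqVneq q0 0; first by rewrite msize0.
rewrite leqNgt; apply/negP => q0t.
(* If [q0], whose leading monomial is the largest, had degree above [t], then twice that monomial
   would exceed the degree of the sum. Its coefficient in each square is the square of the
   coefficient at [mlead q0], so all of these vanish, including the leading coefficient of [q0]. *)
have /memN_msupp_eq0 : (mlead q0 + mlead q0)%MM \notin msupp (\sum_(q <- s) q ^+ 2).
  apply: msize_mdeg_ge; apply: leq_trans st _.
  by move: q0t; rewrite -mlead_deg// mdegD; lia.
rewrite raddf_sum /= => /eqP; rewrite big_seq psumr_eq0 => [|i si]; last first.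
  by rewrite expr2 mleadcMW ?q0max// -expr2 sqr_ge0.
move=> /allP/(_ _ q0s); rewrite q0s /= expr2 mleadcMW// mulf_eq0 orbb.
by rewrite mleadc_eq0 (negbTE q00).
Qed.

(** * Vanishing of polynomials *)

(** Remainder and quotient by [B] recover the lowest digit and the rest. This keeps distinct
    monomials apart under Kronecker's substitution. *)
Lemma digits_inj n (B : nat) (m m' : 'I_n -> nat) :
  (forall i, (m i < B)%N) -> (forall i, (m' i < B)%N) ->
  (\sum_i m i * B ^ i = \sum_i m' i * B ^ i)%N -> m =1 m'.
Proof.
elim: n m m' => [|n IH] m m' mB m'B; first by move=> _ [].
have B0 : (0 < B)%N by apply: leq_ltn_trans (mB ord0).
have split1 (k : 'I_n.+1 -> nat) :
    (\sum_i k i * B ^ i = k ord0 + (\sum_i k (lift ord0 i) * B ^ i) * B)%N.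
  rewrite big_ord_recl expn0 muln1 big_distrl; congr addn.
  by apply: eq_bigr => i _; rewrite /= /bump expnSr mulnA.
rewrite !split1 => E.
have E0 : m ord0 = m' ord0.
  by have := congr1 (modn ^~ B) E; rewrite /= ![(_ + _ * B)%N]addnC !modnMDl !modn_small.
have E1 : (\sum_i m (lift ord0 i) * B ^ i = \sum_i m' (lift ord0 i) * B ^ i)%N.
  by have := congr1 (divn ^~ B) E; rewrite /= ![(_ + _ * B)%N]addnC !divnMDl// !divn_small// !addn0.
have Em := IH _ _ (fun i => mB _) (fun i => m'B _) E1.
by move=> i; case: (unliftP ord0 i) => [j ->|->].
Qed.

Lemma poly_eq0_vanish (R : realDomainType) (p : {poly R}) :
  (forall t, p.[t] = 0) -> p = 0.
Proof.
move=> p0; apply: (@roots_geq_poly_eq0 _ _ [seq k%:R | k <- iota 0 (size p)]).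
- by apply/allP => x _; apply/rootP.
- by rewrite map_inj_uniq ?iota_uniq//; apply: mulrIn; exact: oner_neq0.
- by rewrite size_map size_iota.
Qed.

Section Vanishing.
Variables (R : realType) (N : nat).
Implicit Types (p : {mpoly R[N]}) (z : 'I_N -> R) (i : 'I_N).

(* Kronecker's substitution [z_i = t ^ (B ^ i)] separates the monomials. *)
Lemma mpoly_eq0_vanish p : (forall z, p.@[z] = 0) -> p = 0.
Proof.
move=> p0; pose B := msize p; pose w (m : 'X_{1..N}) := (\sum_i m i * B ^ i)%N.
pose q : {poly R} := \sum_(m <- msupp p) p@_m *: 'X^(w m).
have q0 : q = 0.
  apply: poly_eq0_vanish => t; rewrite -(p0 (fun i => t ^+ (B ^ i))) mevalE horner_sum.
  apply: eq_bigr => m _; rewrite hornerZ hornerXn -prodrXr; congr (_ * _).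
  by apply: eq_bigr => i _; rewrite -exprM mulnC.
apply/mpolyP => m; rewrite mcoeff0.
have [mp|/memN_msupp_eq0//] := boolP (m \in msupp p).
have ltB m' : m' \in msupp p -> forall i, (m' i < B)%N.
  move=> m'p i; apply: leq_ltn_trans (msize_mdeg_lt m'p).
  by rewrite mdegE (bigD1 i)//= leq_addr.
have := congr1 (fun q : {poly R} => q`_(w m)) q0.
rewrite /q coef_sum coef0 (bigD1_seq m)//= coefZ coefXn eqxx mulr1 big1_seq ?addr0//.
move=> m' /andP[m'm m'p]; rewrite coefZ coefXn; case: eqP => [wE|]; last by rewrite mulr0.
case/eqP: m'm; apply/mnmP => i; apply/esym.
by apply: (digits_inj _ _ wE) => j; apply: ltB.
Qed.

Definition upd z i t : 'I_N -> R := fun j => if j == i then t else z j.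

Lemma meval_upd p z i k :
  (forall m, m \in msupp p -> (m i < k)%N) ->
  exists2 q : {poly R}, (size q <= k)%N & forall t, p.@[upd z i t] = q.[t].
Proof.
move=> pk.
exists (\sum_(m <- msupp p) (p@_m * \prod_(j | j != i) z j ^+ m j) *: 'X^(m i)).
  apply: leq_trans (size_sum _ _ _) _; apply/bigmax_leqP_seq => m mp _.
  by rewrite (leq_trans (size_scale_leq _ _))// size_polyXn pk.
move=> t; rewrite mevalE horner_sum; apply: eq_bigr => m _.
rewrite hornerZ hornerXn (bigD1 i)//= /upd eqxx -mulrA [t ^+ _ * _]mulrC; congr (_ * (_ * _)).
by apply: eq_bigr => j /negbTE ->.
Qed.

(** A polynomial with fewer powers of each variable in [D] than there are grid values for it is
    determined along these variables by the grid. The variables are freed one at a time, each time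
    by counting roots of a univariate polynomial. *)
Lemma meval_grid p (D : pred 'I_N) (S : 'I_N -> seq R) z :
  (forall i, D i -> uniq (S i)) ->
  (forall i m, D i -> m \in msupp p -> (m i < size (S i))%N) ->
  (forall z', (forall i, D i -> z' i \in S i) -> (forall i, ~~ D i -> z' i = z i) ->
    p.@[z'] = 0) ->
  p.@[z] = 0.
Proof.
move=> uS degS p0.
(* Coordinates in [D] below [k] are already free, those from [k] on still range over the grid. *)
suff H k : (k <= N)%N -> forall z', (forall i, D i -> (k <= i)%N -> z' i \in S i) ->
    (forall i, ~~ D i -> z' i = z i) -> p.@[z'] = 0.
  by apply: (H N) => // i _; rewrite leqNgt ltn_ord.
elim: k => [_|k IH kN] z' z'S z'D; first by apply: p0 => // i /z'S; exact.
pose i := Ordinal kN.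
have z'E : z' = upd z' i (z' i) by apply: funext => j; rewrite /upd; case: eqP => // ->.
have [Di|Di] := boolP (D i); last first.
  apply: (IH (ltnW kN)) => // j Dj; rewrite leq_eqVlt => /predU1P[kj|]; last exact: z'S.
  by case/negP: Di; rewrite (_ : i = j)//; apply: val_inj.
have [q sq qE] := meval_upd z' (fun m => degS i m Di).
rewrite z'E qE (@roots_geq_poly_eq0 _ q (S i)) ?horner0 ?uS//.
apply/allP => t tS; apply/rootP; rewrite -qE; apply: (IH (ltnW kN)) => j Dj.
  rewrite leq_eqVlt /upd => /predU1P[kj|kj].
    by rewrite (_ : j = i) ?eqxx//; apply/val_inj.
  by case: eqP => [->//|_]; exact: z'S.
by rewrite /upd; case: eqP => [ji|_]; [move: Dj; rewrite ji Di|exact: z'D].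
Qed.

End Vanishing.

(** * Products of spheres *)

Section ProductOfSpheres.
Variables (R : realType) (N a : nat) (blk : 'I_N -> 'I_a) (hd : 'I_a -> 'I_N).
Hypothesis hdK : cancel hd blk.
Implicit Types (p : {mpoly R[N]}) (z : 'I_N -> R) (i : 'I_N) (m : 'X_{1..N}).

Definition sph l : {mpoly R[N]} := 1 - \sum_(i | blk i == l) 'X_i ^+ 2.

Definition on_spheres : set ('I_N -> R) := [set z | forall l, (sph l).@[z] = 0].

Lemma meval_sph l z : (sph l).@[z] = 1 - \sum_(i | blk i == l) z i ^+ 2.
Proof.
rewrite /sph mevalB meval1. congr (_ - _). rewrite raddf_sum; apply: eq_bigr => i _ /=.
by rewrite rmorphXn /= mevalXU.
Qed.

Lemma msize_sph l : (msize (sph l) <= 3)%N.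
Proof.
apply: msizeB_leq; first by rewrite msize1.
apply: msize_sum_leq => i _; rewrite expr2.
exact: (@msizeM_leq _ _ 1 1 _ _ (msizeXU_leq _ _) (msizeXU_leq _ _)).
Qed.

(** The normal forms modulo the sphere equations: no square of a distinguished coordinate occurs. *)
Definition hd_reduced p := forall m l, m \in msupp p -> (m (hd l) <= 1)%N.

Lemma hd_reducedD p q : hd_reduced p -> hd_reduced q -> hd_reduced (p + q).
Proof.
move=> rp rq m l /msuppD_le; rewrite mem_cat => /orP[]; [exact: rp|exact: rq].
Qed.

Lemma hd_reducedZ c p : hd_reduced p -> hd_reduced (c *: p).
Proof. by move=> rp m l /msuppZ_le; apply: rp. Qed.

Definition reducible d p := exists r,
  [/\ hd_reduced r, (msize r <= d.+1)%N & trunc_ideal sph d (p - r)].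

Lemma reducible0 d : reducible d 0.
Proof.
exists 0; split; first by move=> m l; rewrite msupp0.
- by rewrite msize0.
- by rewrite subrr; exact: trunc_ideal0.
Qed.

Lemma reducibleD d p q : reducible d p -> reducible d q -> reducible d (p + q).
Proof.
move=> [r [rr sr ir]] [r' [rr' sr' ir']]; exists (r + r'); split.
- exact: hd_reducedD.
- exact: msizeD_leq.
- by rewrite opprD addrACA; exact: trunc_idealD.
Qed.

Lemma reducibleZ d c p : reducible d p -> reducible d (c *: p).
Proof.
move=> [r [rr sr ir]]; exists (c *: r); split.
- exact: hd_reducedZ.
- exact: msizeZ_leq.
- by rewrite -scalerBr; exact: trunc_idealZ.
Qed.

Lemma reducible_sum d (J : Type) (s : seq J) (P : pred J) (F : J -> {mpoly R[N]}) :
  (forall j, P j -> reducible d (F j)) -> reducible d (\sum_(j <- s | P j) F j).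
Proof.
move=> rF; elim/big_ind: _ => //; first exact: reducible0.
by move=> p q; exact: reducibleD.
Qed.

Let hd_deg m := (\sum_l m (hd l))%N.

(** The square of a distinguished variable is replaced by one minus the other squares of its block,
    minus [sph l]. All terms keep degree at most [mdeg m], and the total exponent [hd_deg] of the
    distinguished variables drops, which is the induction measure. *)
Lemma reducibleX d m : (mdeg m <= d)%N -> reducible d 'X_[m].
Proof.
have [n] := ubnP (hd_deg m); elim: n => // n IH in m *; rewrite ltnS => mn md.
have [red|] := pselect (forall l, (m (hd l) <= 1)%N).
  exists 'X_[m]; split; last by rewrite subrr; exact: trunc_ideal0.
  - by move=> m' l; rewrite msuppX inE => /eqP ->.
  - by rewrite msizeX ltnS.
move=> /existsNP[l /negP]; rewrite -ltnNge => ml; set h := hd l in ml.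
pose m' := (m - U_(h) *+ 2)%MM.
have mE : m = (m' + U_(h) *+ 2)%MM.
  apply/esym/submK/mnm_lepP => i; rewrite mulmnE mnm1E.
  by case: eqP => [<-|]; rewrite ?mul1n ?mul0n.
have hd_degD m1 m2 : hd_deg (m1 + m2)%MM = (hd_deg m1 + hd_deg m2)%N.
  by rewrite /hd_deg -big_split; apply: eq_bigr => k _; rewrite mnmDE.
have XE : 'X_[m] = 'X_[m'] - \sum_(i | (blk i == l) && (i != h)) 'X_[m' + U_(i) *+ 2]
    - 'X_[m'] * sph l.
  have -> : sph l = 1 - ('X_h ^+ 2 + \sum_(i | (blk i == l) && (i != h)) 'X_i ^+ 2).
    by rewrite /sph (bigD1 h)//= hdK.
  rewrite mE mpolyXD -mpolyXn.
  rewrite (eq_bigr (fun i => 'X_[m'] * 'X_i ^+ 2)); last first.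
    by move=> i _; rewrite mpolyXD mpolyXn.
  by rewrite -mulr_sumr; ring.
have degm' : (mdeg m' + 2 = mdeg m)%N by rewrite mE mdegD mdegMn mdeg1.
have hdm' : (hd_deg m' < hd_deg m)%N.
  rewrite mE hd_degD -[X in (X < _)%N]addn0 ltn_add2l /hd_deg (bigD1 l)//=.
  by rewrite mulmnE mnm1E eqxx.
rewrite XE; apply: reducibleD.
  apply: reducibleD; first by apply: IH; [apply: leq_trans mn|lia].
  rewrite -scaleN1r; apply/reducibleZ/reducible_sum => i /andP[/eqP il ih].
  apply: IH; last by rewrite mdegD mdegMn mdeg1 degm'.
  (* The variable [i] lies in block [l] but is not its distinguished one, hence is distinguished for
     no block and adds nothing to [hd_deg]. *)
  rewrite hd_degD [X in (_ + X)%N](_ : _ = 0%N) ?addn0; first exact: leq_trans mn.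
  apply: big1 => k _; rewrite mulmnE mnm1E; case: eqP => [ik|]; last by rewrite mul0n.
  by case/eqP: ih; rewrite ik /h -il ik hdK.
exists 0; split; first by move=> ? ?; rewrite msupp0.
  by rewrite msize0.
rewrite subr0 -scaleN1r; apply/trunc_idealZ/trunc_ideal_gen.
apply: leq_trans (_ : ((mdeg m' + 2).+1 <= _)%N); last by rewrite degm'.
by apply: msizeM_leq; [rewrite msizeX|exact: msize_sph].
Qed.

Lemma reducibleP d p : (msize p <= d.+1)%N -> reducible d p.
Proof.
move=> pd; rewrite (mpolyE p) big_seq; apply: reducible_sum => m mp.
apply/reducibleZ/reducibleX; rewrite -ltnS; apply: leq_trans pd.
exact: msize_mdeg_lt.
Qed.

(* On the points of the product of spheres above a fixed point of the open
   balls, each distinguished coordinate takes two opposite nonzero values, and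
   [p] has degree at most one in it. *)
Lemma hd_reduced_eq0 p : hd_reduced p -> (forall z, on_spheres z -> p.@[z] = 0) -> p = 0.
Proof.
move=> rp p0; apply: mpoly_eq0_vanish => z.
(* The grid values are distinct and at most 1/(N+1), so their squares are too; at most [N] of these
   add up to less than 1, which keeps the point inside the open balls. *)
pose e k : R := (N.+1)%:R^-1 / k.+1%:R.
have N0 : 0 < (N.+1)%:R :> R by rewrite ltr0n.
have e0 k : 0 < e k by rewrite divr_gt0 ?invr_gt0 ?ltr0n.
have e1 k : e k <= (N.+1)%:R^-1.
  by rewrite /e ler_pdivrMr ?ltr0n// ler_peMr ?invr_ge0 ?ler0n// ler1n.
have e_inj : injective e.
  move=> k k' /(mulfI _) E; have /invr_inj/eqP := E (invr_neq0 (lt0r_neq0 N0)).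
  by rewrite eqr_nat => /eqP[].
pose isnh i := hd (blk i) != i.
apply: (@meval_grid _ _ p isnh (fun=> [seq e k | k <- iota 0 (msize p)])).
- by move=> i _; rewrite map_inj_uniq// iota_uniq.
- move=> i m _ mp; rewrite size_map size_iota (leq_ltn_trans _ (msize_mdeg_lt mp))//.
  by rewrite mdegE (bigD1 i)//= leq_addr.
move=> y yS _.
(* What the sphere equation leaves for the square of the distinguished coordinate. *)
pose q l := 1 - \sum_(i | (blk i == l) && isnh i) y i ^+ 2.
have q0 l : 0 < q l.
  have le i : isnh i -> y i ^+ 2 <= (N.+1)%:R^-1.
    move=> /yS/mapP[k _ ->]; apply: le_trans (e1 k); rewrite expr2.
    apply: ler_piMr; first exact: ltW.
    by apply: le_trans (e1 k) _; rewrite invf_le1 ?ler1n.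
  rewrite subr_gt0; apply: (@le_lt_trans _ _ (\sum_(i < N) (N.+1)%:R^-1)).
    rewrite big_mkcond; apply: ler_sum => i _; case: ifP => [/andP[_]/le//|_].
    by rewrite invr_ge0 ltW.
  rewrite sumr_const card_ord -[X in X < _]mulr_natl ltr_pdivrMr// mul1r ltr_nat.
  exact: ltnSn.
apply: (@meval_grid _ _ p (fun i => ~~ isnh i)
  (fun i => [:: Num.sqrt (q (blk i)); - Num.sqrt (q (blk i))])).
- move=> i _; rewrite /= inE andbT; apply/eqP => E.
  have := sqrtr_gt0 (q (blk i)); rewrite q0; lra.
- by move=> i m; rewrite negbK => /eqP <- mp /=; rewrite ltnS rp.
move=> x xS xy; apply: p0 => l; rewrite meval_sph (bigD1 (hd l)) ?hdK//=.
have : x (hd l) ^+ 2 = q l.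
  have := xS (hd l); rewrite /isnh hdK eqxx => /(_ isT).
  by rewrite !inE => /orP[]/eqP->; rewrite ?sqrrN sqr_sqrtr// ltW.
have -> : \sum_(i | (blk i == l) && (i != hd l)) x i ^+ 2 = 1 - q l.
  rewrite /q opprB addrC subrK; apply: eq_big => [i|i /andP[/eqP il ih]].
    by case: eqP => //= <-; rewrite /isnh eq_sym.
  by rewrite xy// negbK /isnh il eq_sym.
by move=> ->; ring.
Qed.

(** Reduction changes neither the values on X nor the degree bound; the remainder then vanishes on X
    and is zero. Membership in the truncated cone thus depends only on values on X, without loss of
    degree. *)
Lemma truncated_nullstellensatz d p :
  (msize p <= d.+1)%N -> (forall z, on_spheres z -> p.@[z] = 0) -> trunc_ideal sph d p.
Proof.
move=> pd p0; have [r [rr _ ir]] := reducibleP pd.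
suff r0 : r = 0 by rewrite r0 subr0 in ir.
apply: hd_reduced_eq0 => // z zX.
by have /eqP := trunc_ideal_meval ir zX; rewrite mevalB p0// sub0r oppr_eq0 => /eqP.
Qed.

Lemma exists_on_spheres : on_spheres !=set0.
Proof.
exists (fun i => (hd (blk i) == i)%:R) => l; rewrite meval_sph (bigD1 (hd l)) ?hdK//=.
rewrite eqxx big1 ?addr0 ?expr1n ?subrr// => i /andP[/eqP -> /negbTE].
by rewrite eq_sym => ->; rewrite expr0n.
Qed.

(** * Constants as order units of the truncated cone *)

Section OrderUnit.
Variable t : nat.
Let Q := sos_plus_ideal sph (2 * t).

(** The monomial is peeled one variable at a time: with [m = m' + U_(i)], the difference of the
    expressions for [m] and [m'] is the square of ['X_[m']] times [1 - 'X_i ^+ 2], and the latter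
    factor is [sph] of the block plus the squares of its other variables. *)
Lemma one_sub_sqrX m : (mdeg m <= t)%N -> Q (1 - 'X_[m] ^+ 2).
Proof.
have [n] := ubnP (mdeg m); elim: n => // n IH in m *; rewrite ltnS => mn mt.
have [->|m0] := eqVneq m 0%MM.
  by rewrite mpolyX0 expr1n subrr; exact: sos_plus_ideal0.
have [i mi] : exists i, m i != 0%N.
  apply/existsP; apply: contraNT m0; rewrite negb_exists => /forallP m0.
  by apply/eqP/mnmP => i; rewrite mnm0E; apply/eqP; move: (m0 i); rewrite negbK.
pose m' := (m - U_(i))%MM.
have mE : m = (m' + U_(i))%MM by rewrite submK// lep1mP.
have degm : mdeg m = (mdeg m').+1 by rewrite mE mdegD mdeg1 addn1.
have -> : 1 - 'X_[m] ^+ 2 = (1 - 'X_[m'] ^+ 2) + ('X_[m'] ^+ 2 * sph (blk i)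
    + \sum_(j | (blk j == blk i) && (j != i)) ('X_[m'] * 'X_j) ^+ 2) :> {mpoly R[N]}.
  rewrite mE mpolyXD /sph (bigD1 i)//=.
  rewrite [X in _ = _ + (_ + X)](eq_bigr (fun j => 'X_[m'] ^+ 2 * 'X_j ^+ 2)); last first.
    by move=> j _; rewrite exprMn.
  rewrite -mulr_sumr; ring.
apply: sos_plus_idealD; first by apply: IH; lia.
apply: sos_plus_idealD.
  apply/sos_plus_ideal_ideal/trunc_ideal_gen.
  apply: leq_trans (_ : ((2 * mdeg m' + 2).+1 <= _)%N); last by lia.
  by apply: msizeM_leq; [rewrite mpolyXn msizeX mdegMn mulnC|exact: msize_sph].
apply: sos_plus_ideal_sum => j _; apply: sos_plus_ideal_sqr.
by rewrite -mpolyXD msizeX mdegD mdeg1 addn1 -degm ltnS.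
Qed.

Lemma mnm_split m k : (k <= mdeg m)%N -> exists2 m', (m' <= m)%MM & mdeg m' = k.
Proof.
elim: k => [_|k IH km].
  by exists 0%MM; rewrite ?mdeg0//; apply/mnm_lepP => i; rewrite mnm0E.
have [m' m'm m'k] := IH (ltnW km).
have [i mi] : exists i, (m' i < m i)%N.
  apply/existsP; apply: contraTT km; rewrite negb_exists -leqNgt => /forallP ge.
  by rewrite -m'k !mdegE leq_sum// => i _; rewrite leqNgt.
exists (m' + U_(i))%MM; last by rewrite mdegD mdeg1 m'k addn1.
apply/mnm_lepP => j; rewrite mnmDE mnm1E; case: eqP => [<-|_]; first by rewrite addn1.
by rewrite addn0; apply/mnm_lepP.
Qed.

(** A monomial of degree at most [2 * t] is a product of monomials b and c of degree at most [t],
    and 2 (1 + s b c) = (1 - b^2) + (1 - c^2) + (b + s c)^2 for a sign s. *)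
Lemma one_add_signX (s : R) m : s ^+ 2 = 1 -> (mdeg m <= 2 * t)%N -> Q (1 + s *: 'X_[m]).
Proof.
move=> s1 mt; have [b bm bk] := mnm_split (geq_minr t (mdeg m)).
pose c := (m - b)%MM; have mE : m = (b + c)%MM by rewrite addmC submK.
have degm : mdeg m = (mdeg b + mdeg c)%N by rewrite mE mdegD.
have bt : (mdeg b <= t)%N by lia.
have ct : (mdeg c <= t)%N by lia.
have -> : 1 + s *: 'X_[m] = 2^-1 *: ((1 - 'X_[b] ^+ 2) + (1 - 'X_[c] ^+ 2)
    + ('X_[b] + s *: 'X_[c]) ^+ 2).
  rewrite mE mpolyXD sqrrD exprZn s1 scale1r.
  rewrite (_ : _ + _ + _ = 2%:R *: (1 + s *: ('X_[b] * 'X_[c]))).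
    by rewrite scalerA mulVf ?scale1r// pnatr_eq0.
  by rewrite scaler_nat -scalerAr; ring.
apply: sos_plus_idealZ; first by rewrite invr_ge0 ler0n.
apply: sos_plus_idealD; last first.
  by apply/sos_plus_ideal_sqr/msizeD_leq; rewrite ?msizeZ_leq ?msizeX.
by apply: sos_plus_idealD; exact: one_sub_sqrX.
Qed.

(** The sum of the absolute values of the coefficients serves as [C]: each term plus its share is a
    nonnegative multiple of 1 plus or minus a monomial. This supplies feasible points for the
    truncated programs. *)
Lemma sos_plus_ideal_order_unit p :
  (msize p <= (2 * t).+1)%N -> exists C : R, Q (C%:MP + p).
Proof.
move=> pt; exists (\sum_(m <- msupp p) `|p@_m|).
have -> : (\sum_(m <- msupp p) `|p@_m|)%:MP + p =
    \sum_(m <- msupp p) ((`|p@_m|)%:MP + p@_m *: 'X_[m]).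
  by rewrite big_split/= -mpolyE raddf_sum.
rewrite big_seq; apply: sos_plus_ideal_sum => m mp /=.
have mt : (mdeg m <= 2 * t)%N.
  by rewrite -ltnS; apply: leq_trans pt; exact: msize_mdeg_lt.
have -> : (`|p@_m|)%:MP + p@_m *: 'X_[m] = `|p@_m| *: (1 + (-1) ^+ (p@_m < 0)%R *: 'X_[m]).
  rewrite scalerDr scalerA -alg_mpolyC; congr (_ + _ *: _).
  by rewrite mulrC -numEsign.
by apply: sos_plus_idealZ => //; apply: one_add_signX => //; rewrite sqrr_sign.
Qed.

End OrderUnit.

End ProductOfSpheres.

(** * Attainment for polynomial programs *)

(** Membership in a row space is a finite system of linear equations, given by [cokermx]; in this
    form a linear condition can enter a [polyclosed] set. *)
Lemma row_space_subspace (F : fieldType) D (Y : set 'rV[F]_D) :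
  Y 0 -> (forall c u v, Y u -> Y v -> Y (c *: u + v)) ->
  exists K (M : 'M[F]_(K, D)), forall y, Y y <-> (y <= M)%MS.
Proof.
move=> Y0 YD; have [K [M [YM sM]]] := finite_span Y.
exists K, M => y; split; first exact: sM.
move=> /submxP[c ->]; rewrite mulmx_sum_row.
elim/big_ind: _ => // [u v Yu Yv|i _].
  by rewrite -(scale1r u); exact: YD.
by rewrite -(addr0 (_ *: _)); exact: YD.
Qed.

(** Evaluation at a point is a linear functional of the finitely many coefficients, and finitely
    many evaluations at points of X span all those at points of X. The weights [c k z] do not depend
    on the polynomial. *)
Lemma interpolation (R : realType) (N d : nat) (X : set ('I_N -> R)) :
  exists K (x : 'I_K -> 'I_N -> R) (c : 'I_K -> ('I_N -> R) -> R),
    (forall k, X (x k)) /\ forall (p : {mpoly R[N]}) z,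
      (msize p <= d.+1)%N -> X z -> p.@[z] = \sum_k c k z * p.@[x k].
Proof.
pose mon (z : 'I_N -> R) : 'rV[R]_#|{: 'X_{1..N < d.+1}}| :=
  \row_j ('X_[bmnm (enum_val j)] : {mpoly R[N]}).@[z].
have [K [M [YM sM]]] := finite_span [set mon z | z in X].
have /choice[x xP] : forall k, exists z, X z /\ mon z = row k M.
  by move=> k; have [z Xz zE] := YM k; exists z.
exists K, x, (fun k z => (mon z *m pinvmx M) 0 k); split=> [k|p z pd Xz].
  by have [] := xP k.
pose coef : 'cV[R]_#|{: 'X_{1..N < d.+1}}| := \col_j p@_(bmnm (enum_val j)).
have pE y : p.@[y] = (mon y *m coef) 0 0.
  rewrite {1}(mpolywE pd) raddf_sum mxE (reindex _ (onW_bij _ (enum_val_bij _)))/=.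
  by apply: eq_bigr => j _; rewrite mevalZ !mxE mulrC.
have zM : (mon z <= M)%MS by apply: sM; exists z.
transitivity ((mon z *m pinvmx M *m (M *m coef)) 0 0).
  by rewrite mulmxA mulmxKpV.
rewrite mxE; apply: eq_bigr => k _; congr (_ * _).
have [_ xk] := xP k; rewrite pE xk.
by rewrite -row_mul [RHS]mxE.
Qed.

Section Attainment.
Variables (R : realType) (N d : nat) (X : set ('I_N -> R)).
Variables (V : Type) (H : set V) (F : V -> {mpoly R[N]}) (g : V -> R).
Hypothesis F_deg : forall v, H v -> (msize (F v) <= d.+1)%N.
(** Only the values on X must form an affine family; [V] itself carries no linear structure. *)
Hypothesis F_affine : forall v1 v2 v3 c, H v1 -> H v2 -> H v3 ->
  exists2 v, H v & forall z, X z ->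
    (F v).@[z] = (F v1).@[z] + c * ((F v2).@[z] - (F v3).@[z]).
Variables (g0 : R) (L : finType) (w : L -> R) (y : L -> 'I_N -> R).
Hypothesis y_X : forall l, X (y l).
Hypothesis gE : forall v, H v -> g v = g0 - \sum_l w l * (F v).@[y l].
Hypothesis F_bounded : forall z c, X z -> exists B, forall v, H v ->
  (forall z, X z -> 0 <= (F v).@[z]) -> c <= g v -> (F v).@[z] <= B.

(* The feasible set is described by closed conditions on the values of [F v]
   at the interpolation points and on auxiliary variables indexed by [J]. *)
Lemma sup_attained_lifted K (x : 'I_K -> 'I_N -> R) (c : 'I_K -> ('I_N -> R) -> R)
    (J : choiceType) (Z : set ('I_K + J -> R)) (bJ : ('I_K -> R) -> J -> R) (S : set V) :
  (forall k, X (x k)) ->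
  (forall (p : {mpoly R[N]}) z,
      (msize p <= d.+1)%N -> X z -> p.@[z] = \sum_k c k z * p.@[x k]) ->
  polyclosed Z ->
  (forall u B, Z u -> (forall k, u (inl k) <= B k) -> forall j, `|u (inr j)| <= bJ B j) ->
  (forall v, S v -> H v) ->
  (forall v, S v -> forall z, X z -> 0 <= (F v).@[z]) ->
  (forall v, S v -> exists2 u, Z u & forall k, u (inl k) = (F v).@[x k]) ->
  (forall v u, H v -> Z u -> (forall k, u (inl k) = (F v).@[x k]) -> S v) ->
  S !=set0 -> sup_attained S g.
Proof.
move=> xX cE cZ bZ SH S_ge0 SZ ZS [v0 Sv0].
(* Only feasible points at least as good as [v0] matter, and [F_bounded] at the level [g v0] bounds
   their values at the interpolation points. *)
have /choice[B BP] := fun k => F_bounded (g v0) (xX k).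
(* Subtracting the values of [F v0] turns the affine family of value vectors into a linear
   subspace. *)
pose Y (r : 'rV[R]_K) := exists2 v, H v & forall k, r 0 k = (F v).@[x k] - (F v0).@[x k].
have [n [M YM]] : exists n (M : 'M[R]_(n, K)), forall r, Y r <-> (r <= M)%MS.
  apply: row_space_subspace.
    by exists v0 => [|k]; [exact: SH|rewrite mxE subrr].
  move=> e r1 r2 [v1 H1 E1] [v2 H2 E2].
  have [v Hv vE] := F_affine e H2 H1 (SH _ Sv0).
  by exists v => // k; rewrite vE// !mxE E1 E2; ring.
pose dif (u : 'I_K + J -> R) : 'rV[R]_K := \row_k (u (inl k) - (F v0).@[x k]).
have difM u j : (dif u *m cokermx M) 0 j = \sum_k (u (inl k) + - (F v0).@[x k]) * cokermx M k j.
  by rewrite mxE; apply: eq_bigr => k _; congr (_ * _); rewrite mxE.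
(* The level [g v0] itself is not imposed: [Z'] consists of values of feasible points and contains
   those of every feasible point above that level, which is enough for the maximum. *)
pose Z' := Z `&` ([set u | forall j, \sum_k (u (inl k) + - (F v0).@[x k]) * cokermx M k j = 0]
   `&` ([set u | forall k, 0 <= u (inl k)] `&` [set u | forall k, u (inl k) <= B k])).
(* Interpolating at the points [y l] makes the objective, up to sign and constant, a linear function
   of the values at the points [x k]. *)
pose obj (u : 'I_K + J -> R) := \sum_k (\sum_l w l * c k (y l)) * u (inl k).
have gobj v u : H v -> (forall k, u (inl k) = (F v).@[x k]) -> g v = g0 - obj u.
  move=> Hv uE; rewrite gE//; congr (_ - _).
  under eq_bigr => l _ do rewrite (cE _ _ (F_deg Hv) (y_X l)) mulr_sumr.
  rewrite exchange_big; apply: eq_bigr => k _; rewrite mulr_suml.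
  by apply: eq_bigr => l _; rewrite uE mulrA.
have SZ' v : S v -> g v0 <= g v -> exists2 u, Z' u & forall k, u (inl k) = (F v).@[x k].
  move=> Sv gv; have [u Zu uE] := SZ v Sv; exists u => //.
  split=> //; split; last split.
  - have : Y (dif u) by exists v => [|k]; [exact: SH|rewrite mxE uE].
    by move=> /YM; rewrite submxE => /eqP E j; rewrite -difM E mxE.
  - by move=> k; rewrite uE S_ge0.
  - by move=> k; rewrite uE BP//; [exact: SH|exact: S_ge0].
have Z'S u : Z' u -> exists2 v, S v & forall k, u (inl k) = (F v).@[x k].
  move=> [Zu [aff _]]; have /YM[v Hv vE] : (dif u <= M)%MS.
    by rewrite submxE; apply/eqP/rowP => j; rewrite difM aff mxE.
  have uE k : u (inl k) = (F v).@[x k].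
    by have := vE k; rewrite mxE => /addIr.
  by exists v => //; exact: ZS Hv Zu uE.
have [u Z'u umin] : exists2 u, Z' u & forall u', Z' u' -> obj u <= obj u'.
  apply: (@polyfun_min R _ obj Z'
    (fun i => if i is inr j then - bJ B j else 0)
    (fun i => match i with inr j => bJ B j | inl k => B k end)).
  - apply: polyfun_sum => k; apply: polyfunM; [exact: polyfun_cst|exact: polyfun_proj].
  - apply: polyclosedI => //; apply: polyclosedI.
      apply: polyclosed_forall => j; apply: polyclosed_eq; last exact: polyfun_cst.
      apply: polyfun_sum => k; apply: polyfunM; last exact: polyfun_cst.
      by apply: polyfunD; [exact: polyfun_proj|exact: polyfun_cst].
    apply: polyclosedI; apply: polyclosed_forall => k.
      by apply: polyclosed_ge0; exact: polyfun_proj.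
    by apply: polyclosed_le; [exact: polyfun_proj|exact: polyfun_cst].
  - move=> u [Zu [_ [u0 uB]]] [k|j]; first by rewrite u0 uB.
    by rewrite -ler_norml; exact: bZ.
  - by have [u Z'u _] := SZ' v0 Sv0 (lexx _); exists u.
have [v Sv vE] := Z'S u Z'u; exists v => // _ [v' Sv' <-].
have max v1 : S v1 -> g v0 <= g v1 -> g v1 <= g v.
  move=> Sv1 gv1; have [u1 Z'u1 u1E] := SZ' v1 Sv1 gv1.
  rewrite (gobj v u) ?(gobj v1 u1)//; try exact: SH.
  by rewrite lerB// umin.
have [/max->//|/ltW lt] := leP (g v0) (g v').
by rewrite (le_trans lt)// max.
Qed.

Lemma nonneg_sup_attained :
  let S := [set v | H v /\ forall z, X z -> 0 <= (F v).@[z]] in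
  S !=set0 -> sup_attained S g.
Proof.
move=> S; have [K [x [c [xX cE]]]] := interpolation d X.
apply: (@sup_attained_lifted K x c void
  [set u | forall z : {z | X z}, 0 <= \sum_k c k (sval z) * u (inl k)] (fun _ _ => 0)) => //.
- apply: polyclosed_forall => z; apply/polyclosed_ge0/polyfun_sum => k.
  by apply: polyfunM; [exact: polyfun_cst|exact: polyfun_proj].
- by move=> v [].
- by move=> v [].
- move=> v [Hv v0]; exists (fun i => if i is inl k then (F v).@[x k] else 0) => // -[z Xz] /=.
  by rewrite -cE ?v0// F_deg.
- move=> v u Hv uZ uE; split=> // z Xz; rewrite (cE _ _ (F_deg Hv) Xz).
  by have := uZ (exist _ z Xz); under eq_bigr do rewrite uE.
Qed.

End Attainment.

Lemma sup_attained_eq (R : realType) (V : Type) (S S' : set V) (g g' : V -> R) :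
  (forall v, S v <-> S' v) -> g =1 g' -> sup_attained S g -> sup_attained S' g'.
Proof.
move=> SS' gg' [v Sv vmax]; exists v; first exact/SS'.
by move=> _ [v' /SS' Sv' <-]; rewrite -!gg'; apply: vmax; exists v'.
Qed.

(** In the lifted set for sums of squares, the variable indexed by [(i, k)] is the value of the
    [i]-th squared polynomial at the [k]-th interpolation point. *)
Lemma program_sup_attained (R : realType) (N a : nat) (blk : 'I_N -> 'I_a)
    (hd : 'I_a -> 'I_N) (t : nat) (V : Type) (H : set V) (F : V -> {mpoly R[N]})
    (g : V -> R) (g0 : R) (L : finType) (w : L -> R) (y : L -> 'I_N -> R) :
  let X := on_spheres blk in
  cancel hd blk ->
  (forall v, H v -> (msize (F v) <= (2 * t).+1)%N) ->
  (forall v1 v2 v3 c, H v1 -> H v2 -> H v3 -> exists2 v, H v & forall z, X z ->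
    (F v).@[z] = (F v1).@[z] + c * ((F v2).@[z] - (F v3).@[z])) ->
  (forall l, X (y l)) ->
  (forall v, H v -> g v = g0 - \sum_l w l * (F v).@[y l]) ->
  (forall z c, X z -> exists B, forall v, H v ->
    (forall z, X z -> 0 <= (F v).@[z]) -> c <= g v -> (F v).@[z] <= B) ->
  let S := [set v | H v /\ sos_plus_ideal (sph R blk) (2 * t) (F v)] in
  S !=set0 ->
  sup_attained [set v | H v /\ forall z, X z -> 0 <= (F v).@[z]] g /\ sup_attained S g.
Proof.
move=> X hdK F_deg F_affine y_X gE F_bounded S S0; split.
  apply: (nonneg_sup_attained F_deg F_affine y_X gE F_bounded).
  by have [v [Hv Qv]] := S0; exists v; split=> // z; exact: sos_plus_ideal_meval_ge0 Qv.
have [K [x [c [xX cE]]]] := interpolation (2 * t) X.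
pose ev (q : {mpoly R[N]}) : 'rV[R]_K := \row_k q.@[x k].
(* Value vectors of admissible square roots; as a linear subspace, [U] can be imposed on each row by
   equations. *)
pose U := [set ev q | q in [set q : {mpoly R[N]} | (msize q <= t.+1)%N]].
have UD e u v : U u -> U v -> U (e *: u + v).
  move=> [p pt <-] [q qt <-]; exists (e *: p + q); first exact/msizeD_leq/qt/msizeZ_leq.
  by apply/rowP => k; rewrite !mxE mevalD mevalZ.
have U0 : U 0.
  by exists 0; [rewrite /= msize0|apply/rowP => k; rewrite !mxE meval0].
have UZ e u : U u -> U (e *: u) by move=> Uu; rewrite -[_ *: _]addr0; exact: UD.
have [n [M UM]] := row_space_subspace U0 UD.
pose usq (u : 'I_K + 'I_K * 'I_K -> R) i : 'rV[R]_K := \row_k u (inr (i, k)).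
pose Z := [set u : 'I_K + 'I_K * 'I_K -> R |
    forall k, u (inl k) = \sum_i u (inr (i, k)) * u (inr (i, k))]
  `&` [set u | forall i j, \sum_k u (inr (i, k)) * cokermx M k j = 0].
have usqM u i j : (usq u i *m cokermx M) 0 j = \sum_k u (inr (i, k)) * cokermx M k j.
  by rewrite mxE; apply: eq_bigr => k _; congr (_ * _); rewrite mxE.
have ev_sum (I : finType) (q : I -> {mpoly R[N]}) k :
    (\sum_i q i ^+ 2).@[x k] = (\sum_i row_sqr (ev (q i))) 0 k.
  by rewrite raddf_sum summxE; apply: eq_bigr => i _; rewrite /= !mxE expr2 mevalM.
apply: (@sup_attained_lifted R N (2 * t) X V H F g F_deg F_affine g0 L w y y_X gE
  F_bounded K x c ('I_K * 'I_K)%type Z (fun B j => 1 + B j.2)) => //.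
- apply: polyclosedI.
    apply: polyclosed_forall => k; apply: polyclosed_eq; first exact: polyfun_proj.
    by apply: polyfun_sum => i; apply: polyfunM; exact: polyfun_proj.
  apply: polyclosed_forall => i; apply: polyclosed_forall => j.
  apply: polyclosed_eq; last exact: polyfun_cst.
  by apply: polyfun_sum => k; apply: polyfunM; [exact: polyfun_proj|exact: polyfun_cst].
(* Each square is at most the whole sum, so r^2 <= B, and this gives |r| <= 1 + B without a square
   root. *)
- move=> u B [usum _] uB [i k] /=; set r := u (inr (i, k)).
  have rB : r ^+ 2 <= B k.
    rewrite (le_trans _ (uB k))// usum (bigD1 i)//= -expr2 lerDl.
    by apply: sumr_ge0 => j _; rewrite -expr2 sqr_ge0.
  have : `|r| ^+ 2 <= B k by rewrite real_normK ?num_real.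
  nra.
- by move=> v [].
- by move=> v [_ Qv] z zX; exact: sos_plus_ideal_meval_ge0 Qv zX.
- move=> v [Hv [p [h [[pt [s pE]] ih FE]]]].
  (* Here the degree bound on the individual squares is recovered from that on their sum. *)
  have Us (i : 'I_(size s)) : U (ev s`_i).
    exists s`_i => //=; apply: (@msize_sum_sqr _ _ _ s); last exact: mem_nth.
    by rewrite -pE -deg_leE.
  have [u' [Uu' u'E]] := sum_row_sqr_bounded U0 UZ Us.
  exists (fun j => match j with inl k => (F v).@[x k] | inr (i, k) => u' i 0 k end) => //.
  split=> [k|i j].
    rewrite FE mevalD (trunc_ideal_meval ih (xX k)) addr0 pE (big_nth 0) big_mkord.
    rewrite ev_sum u'E summxE; apply: eq_bigr => i _.
    by rewrite mxE expr2.
  have /UM := Uu' i; rewrite submxE => /eqP E.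
  transitivity ((u' i *m cokermx M) 0 j); first by rewrite mxE.
  by rewrite E mxE.
- move=> v u Hv [usum uaff] uE; split=> //.
  have /choice[q qP] : forall i, exists q, (msize q <= t.+1)%N /\ ev q = usq u i.
    move=> i; have /UM[q qt qE] : (usq u i <= M)%MS.
      by rewrite submxE; apply/eqP/rowP => j; rewrite usqM uaff mxE.
    by exists q.
  have qt : (msize (\sum_i q i ^+ 2) <= (2 * t).+1)%N.
    apply: msize_sum_leq => i _; rewrite expr2 mul2n -addnn.
    by apply: msizeM_leq; have [] := qP i.
  (* The difference of [F v] and the sum of squares vanishes at the interpolation points; having
     degree at most [2 * t], it vanishes on X and so lies in the truncated ideal. *)
  rewrite -(subrK (\sum_i q i ^+ 2) (F v)) addrC.
  apply: sos_plus_idealD.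
    by apply: sos_plus_ideal_sum => i _; apply: sos_plus_ideal_sqr; have [] := qP i.
  apply/sos_plus_ideal_ideal/(truncated_nullstellensatz hdK).
    by apply: msizeB_leq => //; exact: F_deg.
  move=> z Xz; rewrite (cE _ _ _ Xz); last by apply: msizeB_leq => //; exact: F_deg.
  apply: big1 => k _; rewrite mevalB -uE ev_sum summxE usum.
  rewrite [X in _ - X](_ : _ = \sum_i u (inr (i, k)) * u (inr (i, k))) ?subrr ?mulr0//.
  by apply: eq_bigr => i _; have [_ ->] := qP i; rewrite !mxE expr2.
Qed.

(** * Best rank one approximation *)

Section RankOne.
Variables (R : realType) (a : nat) (dim : 'I_a -> nat) (A : multi_index dim -> R).
Hypothesis dim_ge2 : forall l, (2 <= dim l)%N.

Let N := (\sum_(k < a) dim k)%N.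
Let blk : 'I_N -> 'I_a := tagnat.sig1.
Let hd (l : 'I_a) : 'I_N := tagnat.Rank l (Ordinal (ltnW (dim_ge2 l))).

Let hdK : cancel hd blk.
Proof. by move=> l; exact: tagnat.Rank1K. Qed.

Lemma multisphere_sph : multisphere_polys (R := R) dim = sph R blk.
Proof.
apply: funext => l; rewrite /multisphere_polys /sph; congr (_ - _).
rewrite [RHS](reindex (@tagnat.rank a dim) (onW_bij _ tagnat.rank_bij))/=.
have := @sig_big_dep {mpoly R[N]} 0 +%R 'I_a (fun i => 'I_(dim i)) (pred1 l) (fun _ _ => true)
  (fun i (j : 'I_(dim i)) => ('X_(tagnat.Rank i j) : {mpoly R[N]}) ^+ 2).
rewrite big_pred1_eq => E.
transitivity (\sum_(j < dim l) ('X_(tagnat.Rank l j) : {mpoly R[N]}) ^+ 2).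
  by apply: eq_bigr => j _; rewrite mxE.
rewrite E; apply: eq_big => [p|p _]; rewrite tagnat.rankE//.
by rewrite /blk tagnat.Rank1K andbT.
Qed.

Lemma tensor_poly_meval z :
  (tensor_poly A).@[z] = tensor_form A (fun l => \col_j z (tagnat.Rank l j)).
Proof.
rewrite /tensor_poly /tensor_form raddf_sum; apply: eq_bigr => j _ /=.
rewrite mevalM mevalC rmorph_prod; congr (_ * _); apply: eq_bigr => l _ /=.
by rewrite !mxE mevalXU.
Qed.

Lemma on_spheres_rsphere z :
  on_spheres blk z <-> forall l, rsphere (\col_j z (tagnat.Rank l j) : 'cV[R]_(dim l)).
Proof.
have E l : (sph R blk l).@[z] = 1 - \sum_j (\col_j z (tagnat.Rank l j) : 'cV[R]_(dim l)) j 0 ^+ 2.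
  rewrite -multisphere_sph /multisphere_polys mevalB meval1; congr (_ - _).
  by rewrite raddf_sum; apply: eq_bigr => j _; rewrite /= rmorphXn /= !mxE mevalXU.
by split=> zX l; have := zX l; rewrite /= /rsphere/= E.
Qed.

Lemma col_Rank_surj (x : forall l, 'cV[R]_(dim l)) :
  exists z : 'I_N -> R, forall l, x l = \col_j z (tagnat.Rank l j).
Proof.
pose G (p : {i & 'I_(dim i)}) := x (tag p) (tagged p) 0.
exists (G \o tagnat.sig) => l; apply/colP => j.
by rewrite mxE /= /tagnat.Rank tagnat.rankK.
Qed.

Let F (v : R) : {mpoly R[N]} := tensor_poly A - v%:MP.

Let F_deg d v : (deg (tensor_poly A) <= d)%N -> (msize (F v) <= d.+1)%N.
Proof. by rewrite deg_leE => Ad; apply: msizeB_leq => //; exact: msizeC_leq. Qed.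

Let F_affine (v1 v2 v3 c : R) : setT v1 -> setT v2 -> setT v3 ->
  exists2 v, setT v & forall z, on_spheres blk z ->
    (F v).@[z] = (F v1).@[z] + c * ((F v2).@[z] - (F v3).@[z]).
Proof.
move=> _ _ _; exists (v1 + c * (v2 - v3)) => // z _.
by rewrite !mevalB !mevalC; ring.
Qed.

Let F_bounded z (c : R) : on_spheres blk z -> exists B, forall v, setT v ->
  (forall z, on_spheres blk z -> 0 <= (F v).@[z]) -> c <= v -> (F v).@[z] <= B.
Proof.
by move=> _; exists ((tensor_poly A).@[z] - c) => v _ _ cv; rewrite mevalB mevalC lerB.
Qed.

Let sos_nonempty t : (deg (tensor_poly A) <= 2 * t)%N ->
  exists v, sos_plus_ideal (sph R blk) (2 * t) (F v).
Proof.
rewrite deg_leE => /(sos_plus_ideal_order_unit blk)[C QC]; exists (- C).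
by rewrite /F mpolyCN opprK addrC.
Qed.

Lemma rank_one_attained :
  sup_attained
    [set lambda : R | forall x : forall l : 'I_a, 'cV[R]_(dim l),
      (forall l, rsphere (x l)) -> 0 <= tensor_form A x - lambda]
    (fun lambda => lambda) /\
  forall t : nat, (maxn 1 (uphalf (deg (tensor_poly A))) <= t)%N ->
  sup_attained
    [set lambda : R |
      sos_plus_ideal (multisphere_polys dim) (2 * t) (tensor_poly A - lambda%:MP)]
    (fun lambda => lambda).
Proof.
have [z0 z0X] := exists_on_spheres R hdK.
have attained t : (deg (tensor_poly A) <= 2 * t)%N ->
    sup_attained [set v | setT v /\ forall z, on_spheres blk z -> 0 <= (F v).@[z]] id /\
    sup_attained [set v | setT v /\ sos_plus_ideal (sph R blk) (2 * t) (F v)] id.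
  (* The measure representing the objective is a unit mass at an arbitrary [z0] of X: [v] is the
     value of the form at [z0] minus that of [F v]. *)
  move=> At; apply: (@program_sup_attained R N a blk hd t R setT F id
    ((tensor_poly A).@[z0]) 'I_1 (fun=> 1) (fun=> z0)) => //.
  - by move=> v _; exact: F_deg.
  - by move=> v _; rewrite big_ord1 mul1r mevalB mevalC; ring.
  - by have [v Qv] := sos_nonempty At; exists v.
split=> [|t].
  (* The nonnegativity program involves no order; it is read off at [t] equal to the degree. *)
  have [+ _] := attained _ (leq_pmull (deg (tensor_poly A)) (ltn0Sn 1)).
  apply: sup_attained_eq => // v; split=> /= Sv.
    move=> x xS; have [z xE] := col_Rank_surj x.
    have {}xE : x = (fun l => \col_j z (tagnat.Rank l j)).
      by apply: functional_extensionality_dep => l.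
    rewrite xE in xS *; have [_] := Sv => /(_ z).
    by rewrite mevalB mevalC tensor_poly_meval; apply; apply/on_spheres_rsphere.
  by split=> // z /on_spheres_rsphere/Sv; rewrite mevalB mevalC tensor_poly_meval.
rewrite geq_max multisphere_sph => /andP[_ At].
have /attained[_] : (deg (tensor_poly A) <= 2 * t)%N.
  by move: At; rewrite uphalf_half; lia.
by apply: sup_attained_eq => // v; split=> [[]|].
Qed.

End RankOne.

(** * Real polynomials in complex variables *)

Section RealPart.
Local Open Scope complex_scope.
Variables (R : realType) (N : nat).
Implicit Types (P : {mpoly R[i][N]}) (z : 'I_N -> R).

Definition mpoly_Re P : {mpoly R[N]} := map_mpoly (@complex.Re R) P.

Lemma meval_complex_prod z (m : 'X_{1..N}) :
  \prod_i (z i)%:C ^+ m i = (\prod_i z i ^+ m i)%:C :> R[i].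
Proof. by rewrite rmorph_prod; apply: eq_bigr => i _; rewrite rmorphXn. Qed.

Lemma Re_mulr_complex (c : R[i]) (r : R) : complex.Re (c * r%:C) = complex.Re c * r.
Proof. by case: c => a b /=; rewrite mulr0 subr0. Qed.

Lemma Im_mulr_complex (c : R[i]) (r : R) : complex.Im (c * r%:C) = complex.Im c * r.
Proof. by case: c => a b /=; rewrite mulr0 add0r. Qed.

Lemma meval_mpoly_map (f : {additive R[i] -> R}) P z :
  (forall (c : R[i]) (r : R), f (c * r%:C) = f c * r) ->
  (map_mpoly f P).@[z] = f P.@[fun i => (z i)%:C].
Proof.
move=> fM; have -> : map_mpoly f P = \sum_(m <- msupp P) f P@_m *: 'X_[m].
  apply/mpolyP => m; rewrite mcoeff_map_mpoly {1}(mpolyE P) !raddf_sum.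
  apply: eq_bigr => m' _ /=; rewrite !mcoeffZ !mcoeffX.
  by case: (m' == m); rewrite ?mulr1 ?mulr0 ?raddf0.
rewrite [in RHS](mpolyE P) (raddf_sum (meval (fun i => (z i)%:C))) !raddf_sum.
apply: eq_bigr => m _ /=.
by rewrite !mevalZ !mevalX meval_complex_prod fM.
Qed.

Lemma mpoly_ReE P z : (mpoly_Re P).@[z] = complex.Re P.@[fun i => (z i)%:C].
Proof. exact: meval_mpoly_map Re_mulr_complex. Qed.

(** The coefficientwise imaginary part vanishes at all real points, hence is the zero polynomial. *)
Lemma mpoly_ReK P : (forall z, complex.Im P.@[fun i => (z i)%:C] = 0) ->
  map_mpoly (real_complex R) (mpoly_Re P) = P.
Proof.
move=> P_real; apply/mpolyP => m; rewrite !mcoeff_map_mpoly.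
suff ImP : map_mpoly (@complex.Im R) P = 0.
  have : complex.Im P@_m = 0 by rewrite -[LHS](mcoeff_map_mpoly (@complex.Im R)) ImP mcoeff0.
  by case: (P@_m) => x y /= ->.
apply: mpoly_eq0_vanish => z; rewrite (meval_mpoly_map _ _ Im_mulr_complex).
exact: P_real.
Qed.

Lemma mpoly_Re_map (p : {mpoly R[N]}) : mpoly_Re (map_mpoly (real_complex R) p) = p.
Proof. by apply/mpolyP => m; rewrite !mcoeff_map_mpoly. Qed.

Lemma msize_mpoly_Re P : (msize (mpoly_Re P) <= msize P)%N.
Proof.
rewrite [X in (X <= _)%N]msizeE; apply/bigmax_leqP_seq => m mP _.
apply: msize_mdeg_lt; move: mP; rewrite !mcoeff_msupp mcoeff_map_mpoly.
by apply: contra_neq => ->.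
Qed.

End RealPart.

(** * Two complex spheres as real spheres *)

Section Bisphere.
Local Open Scope complex_scope.
Variables (R : realType) (n : nat).
Local Notation C := R[i].
Local Notation N := (4 * n)%N.

(** Rows 0 and 1 hold the real and imaginary parts of x, rows 2 and 3 those of y; each complex
    sphere is a real sphere in [2 * n] coordinates. Going through [mxvec] lets [mxvecE] compute the
    block of a variable. *)
Definition bisphere_blk (i : 'I_N) : 'I_2 :=
  mxvec (\matrix_(k < 4, j < n) (if (k < 2)%N then ord0 else ord_max)) 0 i.

Lemma bisphere_blkE k (j : 'I_n) :
  bisphere_blk (mxvec_index k j) = if (k < 2)%N then ord0 else ord_max.
Proof. by rewrite /bisphere_blk mxvecE mxE. Qed.

Lemma big_bisphere_blk (T : nmodType) (l : 'I_2) (G : 'I_N -> T) :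
  \sum_(i | bisphere_blk i == l) G i =
  if l == ord0 then \sum_j G (mxvec_index 0 j) + \sum_j G (mxvec_index 1 j)
  else \sum_j G (mxvec_index 2 j) + \sum_j G (mxvec_index 3 j).
Proof.
rewrite big_mkcond (reindex _ (curry_mxvec_bij 4 n))/=.
pose H (k : 'I_4) (j : 'I_n) :=
  if (if (k < 2)%N then ord0 else ord_max) == l then G (mxvec_index k j) else 0.
rewrite (eq_bigr (fun p => H p.1 p.2)); last first.
  by move=> [k j] _; rewrite /= bisphere_blkE.
rewrite -(pair_bigA _ H) /H !big_ord_recl big_ord0/=.
by case: l {H} => [[|[|//]] l2]; rewrite /= ?big1_eq ?add0r ?addr0; congr (_ + _);
  apply: eq_bigr => j _; congr (G (mxvec_index _ _)); apply: val_inj.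
Qed.

Lemma bisphere_polys_sph : @bisphere_polys R n = sph R bisphere_blk.
Proof.
apply: funext => l; rewrite /sph big_bisphere_blk /bisphere_polys /sphere_poly.
by case: l => [[|[|//]] l2]; rewrite /= opprD addrA.
Qed.

Definition cpoint (re im : 'I_4) (z : 'I_N -> R) : 'cV[C]_n :=
  \col_j ((z (mxvec_index re j))%:C + 'i%C * (z (mxvec_index im j))%:C).

Lemma cpointP (x y : 'cV[C]_n) : exists z, x = cpoint 0 1 z /\ y = cpoint 2 3 z.
Proof.
exists (fun i => mxvec (\matrix_(k < 4, j < n)
  [:: complex.Re (x j 0); complex.Im (x j 0); complex.Re (y j 0); complex.Im (y j 0)]`_k) 0 i).
by split; apply/colP => j; rewrite !mxE !mxvecE !mxE /= -complexE.
Qed.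

Lemma sum_sqr_norm_cpoint re im z :
  \sum_j `|cpoint re im z j 0| ^+ 2 =
  (\sum_j z (mxvec_index re j) ^+ 2 + \sum_j z (mxvec_index im j) ^+ 2)%:C.
Proof.
rewrite -big_split rmorph_sum; apply: eq_bigr => j _ /=.
by rewrite -add_Re2_Im2 mxE /=; congr (_%:C); congr (_ ^+ 2 + _ ^+ 2); ring.
Qed.

Lemma on_bisphereP z : on_spheres bisphere_blk z <->
  csphere (cpoint 0 1 z) /\ csphere (cpoint 2 3 z).
Proof.
rewrite /on_spheres /csphere /= !sum_sqr_norm_cpoint.
have E (r : R) : 1 - r%:C = 0 :> C <-> 1 - r = 0.
  by rewrite -(rmorph1 (real_complex R)) -rmorphB; split=> [/complexI//|->].
rewrite !E; split=> [zX|[z0 z1] l].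
  by have := zX ord0; have := zX ord_max; rewrite !meval_sph !big_bisphere_blk.
by rewrite meval_sph big_bisphere_blk; case: l => [[|[|//]] l2].
Qed.

Lemma map_cvar re im z :
  map_mx (meval (fun i => (z i)%:C)) (cvar R n re im) = cpoint re im z.
Proof.
by apply/colP => j; rewrite !mxE mevalD mevalM mevalC !mevalXU.
Qed.

Lemma map_cvarb re im z :
  map_mx (meval (fun i => (z i)%:C)) (cvarb R n re im) = map_mx Num.conj (cpoint re im z).
Proof.
apply/colP => j; rewrite !mxE mevalB mevalM mevalC !mevalXU rmorphD rmorphM /=.
by rewrite /GRing.mul /=; congr (_ +i* _); ring.
Qed.

Lemma msize_cvar re im j : (msize (cvar R n re im j 0%R) <= 2)%N.
Proof.
rewrite mxE msizeD_leq ?msizeXU_leq//.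
by apply: (@msizeM_leq _ _ 0 1); [exact: msizeC_leq|exact: msizeXU_leq].
Qed.

Lemma msize_cvarb re im j : (msize (cvarb R n re im j 0%R) <= 2)%N.
Proof.
rewrite mxE msizeB_leq ?msizeXU_leq//.
by apply: (@msizeM_leq _ _ 0 1); [exact: msizeC_leq|exact: msizeXU_leq].
Qed.

End Bisphere.

Section BisphereProgram.
Local Open Scope complex_scope.
Variables (R : realType) (n : nat).
Hypothesis n_gt0 : (1 <= n)%N.
Local Notation C := R[i].
Local Notation N := (4 * n)%N.
Local Notation spheres := (on_spheres (R := R) (@bisphere_blk n)).

Definition bisphere_hd (l : 'I_2) : 'I_N :=
  mxvec_index (if l == ord0 then 0 else 2) (Ordinal n_gt0).

Lemma bisphere_hdK : cancel bisphere_hd (@bisphere_blk n).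
Proof.
move=> l; rewrite /bisphere_hd bisphere_blkE.
by case: l => [[|[|//]] l2]; apply: val_inj.
Qed.

Lemma bisphere_sosE t (P : {mpoly C[N]}) :
  (forall z, complex.Im P.@[fun i => (z i)%:C] = 0) ->
  bisphere_sos t P <-> sos_plus_ideal (sph R (@bisphere_blk n)) (2 * t) (mpoly_Re P).
Proof.
move=> P_real; rewrite /bisphere_sos bisphere_polys_sph; split.
  by move=> [p Qp <-]; rewrite mpoly_Re_map.
by exists (mpoly_Re P) => //; exact: mpoly_ReK.
Qed.

Variables (V : Type) (H : set V) (P : V -> {mpoly C[N]}) (g : V -> R).
Variable form : V -> 'cV[C]_n -> 'cV[C]_n -> C.
Hypothesis P_size : forall v, H v -> (msize (P v) <= 5)%N.
Hypothesis P_form : forall v z,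
  (P v).@[fun i => (z i)%:C] = form v (cpoint 0 1 z) (cpoint 2 3 z).
Hypothesis form_real : forall v x y, H v -> complex.Im (form v x y) = 0.
Hypothesis form_affine : forall v1 v2 v3 (c : R), H v1 -> H v2 -> H v3 ->
  exists2 v, H v & forall x y, form v x y = form v1 x y + c%:C * (form v2 x y - form v3 x y).
Variables (g0 : R) (L : finType) (w : L -> R) (x0 y0 : L -> 'cV[C]_n).
Hypothesis x0_sphere : forall l, csphere (x0 l).
Hypothesis y0_sphere : forall l, csphere (y0 l).
Hypothesis gE : forall v, H v -> g v = g0 - \sum_l w l * complex.Re (form v (x0 l) (y0 l)).
Hypothesis form_bounded : forall x y c, csphere x -> csphere y -> exists B, forall v, H v ->
  (forall x y, csphere x -> csphere y -> 0 <= form v x y) -> c <= g v ->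
  complex.Re (form v x y) <= B.
Hypothesis sos_nonempty : forall t, (2 <= t)%N ->
  exists2 v, H v & sos_plus_ideal (sph R (@bisphere_blk n)) (2 * t) (mpoly_Re (P v)).

(** The forms are real on Hermitian data, so the real part of the polynomial carries all
    constraints. The size bound 5 means degree four, which fits in [2 * t] exactly when [t] is at
    least 2. *)
Lemma bisphere_program_attained :
  sup_attained [set v | H v /\ forall x y, csphere x -> csphere y -> 0 <= form v x y] g /\
  forall t, (2 <= t)%N -> sup_attained [set v | H v /\ bisphere_sos t (P v)] g.
Proof.
have /choice[z0 z0P] l := cpointP (x0 l) (y0 l).
have form_ge0 v x y : H v -> (0 <= form v x y) = (0 <= complex.Re (form v x y)).
  by move=> Hv; rewrite lecE /= form_real// eqxx.
have nonneg v : H v -> (forall z, spheres z -> 0 <= (mpoly_Re (P v)).@[z]) <->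
    (forall x y, csphere x -> csphere y -> 0 <= form v x y).
  move=> Hv; split=> [v0 x y Sx Sy|v0 z /on_bisphereP[Sx Sy]]; last first.
    by rewrite mpoly_ReE P_form -form_ge0// v0.
  have [z [xE yE]] := cpointP x y.
  have := v0 z; rewrite mpoly_ReE P_form -xE -yE -form_ge0//; apply.
  by apply/on_bisphereP; rewrite -xE -yE.
have attained t : (2 <= t)%N ->
    sup_attained [set v | H v /\ forall z, spheres z -> 0 <= (mpoly_Re (P v)).@[z]] g /\
    sup_attained [set v | H v /\
      sos_plus_ideal (sph R (@bisphere_blk n)) (2 * t) (mpoly_Re (P v))] g.
  move=> t2; apply: (@program_sup_attained R N 2 _ _ t V H (fun v => mpoly_Re (P v)) g
    g0 L w z0 bisphere_hdK).
  - move=> v Hv; apply: leq_trans (msize_mpoly_Re _) _; apply: leq_trans (P_size Hv) _.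
    by lia.
  - move=> v1 v2 v3 c H1 H2 H3; have [v Hv vE] := form_affine c H1 H2 H3.
    exists v => // z _; rewrite !mpoly_ReE !P_form vE.
    by rewrite raddfD /= mulrC Re_mulr_complex mulrC raddfB.
  - by move=> l; apply/on_bisphereP; have [<- <-] := z0P l.
  - move=> v Hv; rewrite gE//; congr (_ - _); apply: eq_bigr => l _.
    by have [xE yE] := z0P l; rewrite mpoly_ReE P_form -xE -yE.
  - move=> z c /on_bisphereP[Sx Sy]; have [B BP] := form_bounded c Sx Sy.
    exists B => v Hv /(nonneg v Hv) v0 cv; rewrite mpoly_ReE P_form.
    exact: BP.
  - by have [v Hv Qv] := sos_nonempty t2; exists v.
split=> [|t t2].
  have [+ _] := attained 2%N isT; apply: sup_attained_eq => // v.
  by split=> -[Hv /(nonneg v Hv)].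
have [_] := attained t t2; apply: sup_attained_eq => // v.
have P_real : H v -> forall z, complex.Im (P v).@[fun i => (z i)%:C] = 0.
  by move=> Hv z; rewrite P_form form_real.
by split=> -[Hv /(bisphere_sosE _ (P_real Hv))].
Qed.

End BisphereProgram.

(** * Relative interior *)

Section RelativeInterior.
Local Open Scope complex_scope.
Variables (R : realType) (m : nat) (S : set 'M[R[i]]_m).

Lemma relint_sub M : relint S M -> S M.
Proof. by move=> [AM wM]; apply: (nbhs_singleton wM). Qed.

(** The point M + e (M - v) lies on the line through [v] and [M], hence in the affine hull, and for
    small [e] in the given neighbourhood of [M]. *)
Lemma relint_extend M v : relint S M -> S v ->
  exists2 e : R, 0 < e & S ((1 + e)%:C *: M - e%:C *: v).
Proof.
move=> rM Sv; have SM := relint_sub rM; case: rM => _ [P MP sP].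
pose D := M - v.
have /choice[f fP] : forall ij : 'I_m * 'I_m, exists f : R, 0 < f /\
    forall e : R, 0 <= e <= f -> P ij.1 ij.2 (M ij.1 ij.2 + e%:C * D ij.1 ij.2).
  move=> [i j] /=; have /nbhs_ballP[b /= b0 bP] := MP i j.
  (* Balls of [R[i]] have their radius in [R[i]]; being positive, it is real. *)
  have [rb bE] : exists rb : R, b = rb%:C.
    exists (complex.Re b); rewrite RRe_real//; exact: gtr0_real.
  have [rd dE] : exists rd : R, `|D i j| = rd%:C.
    by exists (complex.Re `|D i j|); rewrite RRe_real ?normr_real.
  have rd0 : 0 <= rd by rewrite -lecR -dE; exact: normr_ge0.
  rewrite {}bE ltcR in b0 bP *.
  exists (rb / (1 + rd)); split; first by rewrite divr_gt0// ltr_pwDl.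
  move=> e /andP[e0 eb]; apply: bP; rewrite /ball/= opprD addNKr normrN normrM dE.
  rewrite ger0_norm ?ler0c// -rmorphM ltcR.
  rewrite (le_lt_trans (ler_wpM2r rd0 eb))// mulrAC ltr_pdivrMr ?ltr_pwDl//.
  by rewrite ltr_pM2l// ltrDr.
(* Neighbourhoods of matrices are entrywise, and this one value lies below every admissible step
   [f ij]. *)
pose e := (1 + \sum_ij (f ij)^-1)^-1.
have sum0 (Q : pred ('I_m * 'I_m)) : 0 <= \sum_(ij | Q ij) (f ij)^-1.
  by apply: sumr_ge0 => ij _; rewrite invr_ge0 ltW//; have [] := fP ij.
have e0 : 0 < e by rewrite invr_gt0 ltr_pwDl.
exists e => //; rewrite (_ : _ - _ = M + e%:C *: D); last first.
  by rewrite rmorphD rmorph1 scalerDl scale1r /D scalerBr addrA.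
apply: sP => [i j|].
  rewrite !mxE; have [fij0 fijP] := fP (i, j).
  have := fijP e; rewrite /= !mxE; apply; rewrite ltW//=.
  rewrite -(invrK (f (i, j))) lef_pV2 ?posrE ?invr_gt0 ?ltr_pwDl//.
  by rewrite (bigD1 (i, j))//= addrCA lerDl addr_ge0.
exists 2%N, (fun l => [:: 1 + e; - e]`_l), (fun l => [:: M; v]`_l); split.
- by rewrite !big_ord_recl big_ord0 /= addr0 addrK.
- by case=> [[|[|]]].
- rewrite !big_ord_recl big_ord0 /= addr0 rmorphD rmorph1 rmorphN scalerDl scale1r.
  by rewrite scaleNr /D scalerBr addrA.
Qed.

End RelativeInterior.

(** * Hermitian forms *)

Lemma qform_map (K K' : comNzRingType) (f : {rmorphism K -> K'}) n (L : 'M[K]_n) x xb :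
  f (qform L x xb) = qform (map_mx f L) (map_mx f x) (map_mx f xb).
Proof. by rewrite /qform -trace_map_mx !map_mxM map_trmx. Qed.

Lemma tensor_qform_map (K K' : comNzRingType) (f : {rmorphism K -> K'}) n
    (L : 'M[K]_(n * n)) x xb y yb :
  f (tensor_qform L x xb y yb) =
  tensor_qform (map_mx f L) (map_mx f x) (map_mx f xb) (map_mx f y) (map_mx f yb).
Proof. by rewrite /tensor_qform -trace_map_mx !map_mxM -map_trmx !map_mxT. Qed.

Lemma wasserstein_cost_map (K K' : comNzRingType) (f : {rmorphism K -> K'}) n
    (x xb y yb : 'cV[K]_n) :
  f (wasserstein_cost x xb y yb) =
  wasserstein_cost (map_mx f x) (map_mx f xb) (map_mx f y) (map_mx f yb).
Proof. rewrite /wasserstein_cost -trace_map_mx map_mxM !map_mxB !map_mxM. by rewrite !map_trmx. Qed.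

Lemma tensor_qformE (K : comNzRingType) n (L : 'M[K]_(n * n)) (x xb y yb : 'cV[K]_n) :
  tensor_qform L x xb y yb = qform L (x *t y : 'cV_(n * n)) (xb *t yb : 'cV_(n * n)).
Proof. by []. Qed.

Lemma qform_affine (K : comNzRingType) n (L1 L2 L3 : 'M[K]_n) c x xb :
  qform (L1 + c *: (L2 - L3)) x xb =
  qform L1 x xb + c * (qform L2 x xb - qform L3 x xb).
Proof.
rewrite /qform mulmxDr mulmxDl mxtraceD -scalemxAr -scalemxAl mxtraceZ.
by rewrite mulmxBr mulmxBl raddfB.
Qed.

Section MsizeForms.
Variables (A : comNzRingType) (N n : nat).
Implicit Types x xb y yb : 'cV[{mpoly A[N]}]_n.

Lemma msize_mulmx m p q (M : 'M[{mpoly A[N]}]_(m, p)) (M' : 'M[{mpoly A[N]}]_(p, q)) a b :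
  (forall i j, msize (M i j) <= a.+1)%N -> (forall i j, msize (M' i j) <= b.+1)%N ->
  forall i j, (msize ((M *m M') i j) <= (a + b).+1)%N.
Proof.
by move=> Ma Mb i j; rewrite mxE; apply: msize_sum_leq => k _; exact: msizeM_leq.
Qed.

Lemma msize_qform a b (L : 'M[A]_n) x xb :
  (forall j, msize (x j 0%R) <= a.+1)%N -> (forall j, msize (xb j 0%R) <= b.+1)%N ->
  (msize (qform (map_mx (@mpolyC N A) L) x xb) <= (b + a).+1)%N.
Proof.
move=> xa xbb; apply: msize_sum_leq => i _; apply: msize_mulmx => [k j|k j].
  rewrite -[b]addn0; apply: msize_mulmx => [k' j'|k' j']; first by rewrite mxE ord1.
  by rewrite mxE msizeC_leq.
by rewrite ord1.
Qed.

Lemma msize_tensor_qform (L : 'M[A]_(n * n)) x xb y yb :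
  (forall j, msize (x j 0%R) <= 2)%N -> (forall j, msize (xb j 0%R) <= 2)%N ->
  (forall j, msize (y j 0%R) <= 2)%N -> (forall j, msize (yb j 0%R) <= 2)%N ->
  (msize (tensor_qform (map_mx (@mpolyC N A) L) x xb y yb) <= 5)%N.
Proof.
have tens (u v : 'cV[{mpoly A[N]}]_n) :
    (forall j, msize (u j 0%R) <= 2)%N -> (forall j, msize (v j 0%R) <= 2)%N ->
    forall j l, (msize ((u *t v) j l) <= 3)%N.
  move=> u1 v1 j l; case: (mxtens_indexP j) => ju jv; case: (mxtens_indexP l) => lu lv.
  by rewrite tensmxE !ord1; exact: (@msizeM_leq _ _ 1 1).
move=> x1 xb1 y1 yb1; apply: msize_sum_leq => i _; apply: (@msize_mulmx _ _ _ _ _ 2 2).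
  move=> k j; apply: (@msize_mulmx _ _ _ _ _ 2 0) => k' j'; rewrite mxE ?msizeC_leq//.
  exact: tens.
exact: tens.
Qed.

Lemma msize_wasserstein_cost x xb y yb :
  (forall j, msize (x j 0%R) <= 2)%N -> (forall j, msize (xb j 0%R) <= 2)%N ->
  (forall j, msize (y j 0%R) <= 2)%N -> (forall j, msize (yb j 0%R) <= 2)%N ->
  (msize (wasserstein_cost x xb y yb) <= 5)%N.
Proof.
have outer (u v : 'cV[{mpoly A[N]}]_n) :
    (forall j, msize (u j 0%R) <= 2)%N -> (forall j, msize (v j 0%R) <= 2)%N ->
    forall j l, (msize ((u *m v^T) j l) <= 3)%N.
  by move=> u1 v1; apply: (@msize_mulmx _ _ _ _ _ 1 1) => k j; rewrite ?mxE ord1.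
move=> x1 xb1 y1 yb1; apply: msize_sum_leq => i _.
apply: (@msize_mulmx _ _ _ _ _ 2 2) => k j; rewrite mxE [X in _ + X]mxE;
  by apply: msizeB_leq; exact: outer.
Qed.

End MsizeForms.

Section Hermitian.
Local Open Scope complex_scope.
Local Open Scope sesquilinear_scope.
Variables (R : realType).
Local Notation C := R[i].

Definition outer n (x : 'cV[C]_n) : 'M[C]_n := x *m x ^t*.

Lemma hermE n (M : 'M[C]_n) : herm M <-> M ^t* = M.
Proof.
rewrite /herm /= is_hermitianmxE expr0 scale1r.
by split=> [/eqP {2}->|ME]; [|rewrite ME].
Qed.

Lemma adjmxM n m p (A : 'M[C]_(n, m)) (B : 'M[C]_(m, p)) :
  (A *m B) ^t* = B ^t* *m A ^t*.
Proof. by rewrite trmx_mul map_mxM. Qed.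

Lemma herm_affine n (A B D : 'M[C]_n) (c : R) :
  herm A -> herm B -> herm D -> herm (A + c%:C *: (B - D)).
Proof.
move=> /hermE hA /hermE hB /hermE hD; apply/hermE.
rewrite linearD linearZ linearB /= map_mxD map_mxZ map_mxB hA hB hD.
by congr (_ + _ *: _); exact: conjc_real.
Qed.

Lemma herm0 n : herm (0 : 'M[C]_n).
Proof. by apply/hermE; rewrite trmx0 map_mx0. Qed.

Lemma herm_outer n (x : 'cV[C]_n) : herm (outer x).
Proof. by apply/hermE; rewrite /outer adjmxM trmxCK. Qed.

Lemma mxtrace_outer_mul n (x : 'cV[C]_n) (L : 'M[C]_n) :
  \tr (outer x *m L) = qform L x (map_mx Num.conj x).
Proof. by rewrite /outer /qform -mulmxA mxtrace_mulC map_trmx. Qed.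

Lemma qform1 n (x : 'cV[C]_n) :
  qform 1%:M x (map_mx Num.conj x) = \sum_j `|x j 0| ^+ 2.
Proof.
rewrite /qform mulmx1 mxtrace_mulC /mxtrace; apply: eq_bigr => j _.
by rewrite mxE big_ord1 !mxE normCK.
Qed.

Lemma Im_conj_eq (c : C) : c^* = c -> complex.Im c = 0.
Proof. by case: c => a b [] /eqP; rewrite eq_sym -addr_eq0 -mulr2n mulrn_eq0 => /eqP. Qed.

Lemma qform_real n (L : 'M[C]_n) x : herm L ->
  complex.Im (qform L x (map_mx Num.conj x)) = 0.
Proof.
move=> /hermE hL; apply: Im_conj_eq; rewrite /qform map_trmx.
transitivity (\tr ((x ^t* *m L *m x) ^t*)).
  by rewrite -[LHS](trace_map_mx Num.conj) -mxtrace_tr map_trmx.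
by rewrite !adjmxM hL trmxCK mulmxA.
Qed.

Lemma adj_tens m n p q (A : 'M[C]_(m, n)) (B : 'M[C]_(p, q)) :
  (A *t B) ^t* = A ^t* *t B ^t*.
Proof. by rewrite trmx_tens map_mxT. Qed.

Lemma tens_scalel m n p q (c : C) (A : 'M[C]_(m, n)) (B : 'M[C]_(p, q)) :
  (c *: A) *t B = c *: (A *t B).
Proof. by apply/matrixP => i j; rewrite !mxE mulrA. Qed.

Lemma tens_scaler m n p q (c : C) (A : 'M[C]_(m, n)) (B : 'M[C]_(p, q)) :
  A *t (c *: B) = c *: (A *t B).
Proof. by apply/matrixP => i j; rewrite !mxE mulrCA. Qed.

Lemma herm_tensor_herm n (L : 'M[C]_(n * n)) : herm_tensor L -> herm L.
Proof.
move=> [r [A [B [hA hB ->]]]]; apply/hermE; rewrite linear_sum raddf_sum /=.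
apply: eq_bigr => l _; rewrite -[LHS]/((A l *t B l) ^t*) adj_tens.
by have /hermE -> := hA l; have /hermE -> := hB l.
Qed.

Lemma herm_tensorD n (L L' : 'M[C]_(n * n)) :
  herm_tensor L -> herm_tensor L' -> herm_tensor (L + L').
Proof.
move=> [r [A [B [hA hB ->]]]] [r' [A' [B' [hA' hB' ->]]]].
exists (r + r')%N, (fun l => match split l with inl i => A i | inr i => A' i end),
  (fun l => match split l with inl i => B i | inr i => B' i end); split.
- by move=> l; case: split.
- by move=> l; case: split.
- by rewrite big_split_ord /=; congr (_ + _); apply: eq_bigr => i _;
    rewrite ?(unsplitK (inl i)) ?(unsplitK (inr i)).
Qed.

Lemma herm_tensorZ n (L : 'M[C]_(n * n)) (c : R) :
  herm_tensor L -> herm_tensor (c%:C *: L).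
Proof.
move=> [r [A [B [hA hB ->]]]]; exists r, (fun l => c%:C *: A l), B; split=> //.
  move=> l; have := herm_affine c (herm0 n) (hA l) (herm0 n).
  by rewrite add0r subr0.
by rewrite scaler_sumr; apply: eq_bigr => l _; rewrite tens_scalel.
Qed.

Lemma herm_tensor_affine n (A B D : 'M[C]_(n * n)) (c : R) :
  herm_tensor A -> herm_tensor B -> herm_tensor D -> herm_tensor (A + c%:C *: (B - D)).
Proof.
move=> hA hB hD; apply/herm_tensorD/herm_tensorZ/herm_tensorD => //.
have := herm_tensorZ (-1) hD; by rewrite rmorphN rmorph1 scaleN1r.
Qed.

Lemma tensor_qform_real n (L : 'M[C]_(n * n)) (x y : 'cV[C]_n) : herm_tensor L ->
  complex.Im (tensor_qform L x (map_mx Num.conj x) y (map_mx Num.conj y)) = 0.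
Proof.
by move=> /herm_tensor_herm hL; rewrite tensor_qformE -map_mxT; exact: qform_real.
Qed.

Lemma mxtrace_outer_tens_mul n (x y : 'cV[C]_n) (L : 'M[C]_(n * n)) :
  \tr ((outer x *t outer y) *m L) =
  tensor_qform L x (map_mx Num.conj x) y (map_mx Num.conj y).
Proof.
rewrite tensor_qformE -map_mxT -mxtrace_outer_mul /outer.
by rewrite -tensmx_mul -adj_tens.
Qed.

Lemma wasserstein_cost_real n (x y : 'cV[C]_n) :
  complex.Im (wasserstein_cost x (map_mx Num.conj x) y (map_mx Num.conj y)) = 0.
Proof.
apply: Im_conj_eq; rewrite [LHS](wasserstein_cost_map Num.conj).
have K (u : 'cV[C]_n) : map_mx Num.conj (map_mx Num.conj u) = u.
  by apply/matrixP => i j; rewrite !mxE conjCK.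
by rewrite (K x) (K y); exact: mxtrace_mulC.
Qed.

End Hermitian.

(** * Separable and density matrices *)

Section States.
Local Open Scope complex_scope.
Local Open Scope sesquilinear_scope.
Variables (R : realType) (n : nat).
Local Notation C := R[i].

Lemma csphereE (x : 'cV[C]_n) : csphere x <-> \sum_j `|x j 0| ^+ 2 = 1.
Proof. by rewrite /csphere /=; split=> [/subr0_eq//|->]; rewrite ?subrr. Qed.

Lemma qform1_sphere (x : 'cV[C]_n) : csphere x -> qform 1%:M x (map_mx Num.conj x) = 1.
Proof. by rewrite qform1 => /csphereE. Qed.

Lemma outer_density (x : 'cV[C]_n) : csphere x -> density R n (outer x).
Proof.
move=> Sx; split; first exact: herm_outer.
- move=> v; have -> : v ^t* *m outer x *m v = outer (v ^t* *m x).
    by rewrite /outer adjmxM trmxCK !mulmxA.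
  by rewrite /mxtrace sumr_ge0// => i _; rewrite mxE big_ord1 !mxE mul_conjC_ge0.
- by rewrite -(mulmx1 (outer x)) mxtrace_outer_mul qform1_sphere.
Qed.

(** The squared norm moves into the scalar, so that cone generators built from arbitrary vectors can
    be replaced by ones built from points of the sphere. *)
Lemma outer_normalize (x : 'cV[C]_n) : x != 0 ->
  exists (s : R) u, [/\ 0 <= s, csphere u & outer x = s%:C *: outer u].
Proof.
move=> x0; pose N2 := \sum_j `|x j 0| ^+ 2.
have N2_ge0 : 0 <= N2 by apply: sumr_ge0 => j _; rewrite exprn_ge0.
have N2_neq0 : N2 != 0.
  apply: contraNneq x0 => /eqP; rewrite psumr_eq0 => [/allP x0|j _]; last by rewrite exprn_ge0.
  apply/eqP/colP => j; rewrite mxE; apply/eqP.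
  by have := x0 j (mem_index_enum _); rewrite /= expf_eq0 normr_eq0.
pose s := complex.Re N2.
have sE : s%:C = N2 by rewrite RRe_real// ger0_real.
have s_gt0 : 0 < s by rewrite -ltcR sE lt_def N2_neq0.
pose q := Num.sqrt s; have q_gt0 : 0 < q by rewrite sqrtr_gt0.
have q2 : (q%:C) ^+ 2 = N2 by rewrite -rmorphXn sqr_sqrtr ?ltW.
have qn0 : q%:C != 0 by rewrite -(rmorph0 (real_complex R)) (inj_eq (@complexI R)) gt_eqF.
exists s, ((q%:C)^-1 *: x); split; first exact: ltW.
  apply/csphereE; rewrite -[RHS](mulVf N2_neq0) mulr_sumr; apply: eq_bigr => j _.
  by rewrite mxE normrM exprMn normfV [`|q%:C|]ger0_norm ?ler0c ?ltW// exprVn q2.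
rewrite /outer linearZ /= map_mxZ -scalemxAl -scalemxAr !scalerA.
have qc : Num.conj q%:C = q%:C := conjc_real q.
rewrite fmorphV /= qc sE -q2 expr2.
by rewrite mulfK ?divff ?scale1r.
Qed.

(** An atomic measure on X representing [rho]: only unit vectors occur, so the constraints apply at
    every atom. *)
Definition sep_sum (rho : 'M[C]_(n * n)) := exists (L : finType) (w : L -> R) x y,
  [/\ forall l, 0 <= w l, forall l, csphere (x l), forall l, csphere (y l) &
    rho = \sum_l (w l)%:C *: (outer (x l) *t outer (y l))].

Lemma sep_sum0 : sep_sum 0.
Proof.
exists void, (fun=> 0), (fun=> 0), (fun=> 0); split=> [[]|[]|[]|] //.
by rewrite big1// => -[].
Qed.

Lemma sep_sumD rho rho' : sep_sum rho -> sep_sum rho' -> sep_sum (rho + rho').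
Proof.
move=> [L [w [x [y [w0 Sx Sy ->]]]]] [L' [w' [x' [y' [w0' Sx' Sy' ->]]]]].
pose glue T (f : L -> T) (f' : L' -> T) l := match l with inl l => f l | inr l => f' l end.
exists (L + L')%type, (glue _ w w'), (glue _ x x'), (glue _ y y'); split.
- by case.
- by case.
- by case.
- by rewrite big_sumType.
Qed.

Lemma sep_sumZ (c : R) rho : 0 <= c -> sep_sum rho -> sep_sum (c%:C *: rho).
Proof.
move=> c0 [L [w [x [y [w0 Sx Sy ->]]]]]; exists L, (fun l => c * w l), x, y; split=> //.
  by move=> l; rewrite mulr_ge0.
by rewrite scaler_sumr; apply: eq_bigr => l _; rewrite scalerA rmorphM.
Qed.

Lemma sep_sum_outer x y : sep_sum (outer x *t outer y).
Proof.
have outer0 : outer (0 : 'cV[C]_n) = 0 by rewrite /outer mul0mx.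
have [->|x0] := eqVneq x 0; first by rewrite outer0 tens0mx; exact: sep_sum0.
have [->|y0] := eqVneq y 0; first by rewrite outer0 tensmx0; exact: sep_sum0.
have [s [u [s0 Su ->]]] := outer_normalize x0.
have [s' [u' [s0' Su' ->]]] := outer_normalize y0.
rewrite tens_scalel tens_scaler; apply/sep_sumZ/sep_sumZ => //.
exists unit, (fun=> 1), (fun=> u), (fun=> u'); split=> //.
by rewrite (bigD1 tt)//= big1 ?addr0 ?scale1r// => -[].
Qed.

Lemma SEP_sep_sum rho : SEP R n rho -> sep_sum rho.
Proof.
have sums (L : finType) (F : L -> 'M[C]_(n * n)) :
    (forall l, sep_sum (F l)) -> sep_sum (\sum_l F l).
  by move=> sF; elim/big_ind: _ => //; [exact: sep_sum0|move=> *; exact: sep_sumD].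
move=> [r [w [s [w0 sS ->]]]]; apply: (sums) => l; apply: sep_sumZ => //.
have [_ [r' [w' [x [y [w0' ->]]]]]] := sS l.
by apply: sums => l'; apply: sep_sumZ => //; exact: sep_sum_outer.
Qed.

Lemma SEP_outer x y : SEP R n (outer x *t outer y).
Proof.
exists 1%N, (fun=> 1), (fun=> outer x *t outer y); split=> //; last first.
  by rewrite big_ord1 rmorph1 scale1r.
move=> _; split.
  exists 1%N, (fun=> outer x), (fun=> outer y); split=> [l|l|]; try exact: herm_outer.
  by rewrite big_ord1.
exists 1%N, (fun=> 1), (fun=> x), (fun=> y); split=> //.
by rewrite big_ord1 rmorph1 scale1r.
Qed.

(** The eigenvalues are values of the form at unit eigenvectors, hence nonnegative, and they add up
    to the trace: a density matrix is an atomic probability measure on the sphere. *)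
Lemma density_spectral (M : 'M[C]_n) : density R n M ->
  exists (d : 'I_n -> R) (u : 'I_n -> 'cV[C]_n),
    [/\ forall k, 0 <= d k, \sum_k d k = 1, forall k, csphere (u k) &
      M = \sum_k (d k)%:C *: outer (u k)].
Proof.
move=> [hM M_ge0 trM].
have /orthomx_spectralP ME := hermitian_normalmx hM.
have PU := spectral_unitarymx M; rewrite (invmx_unitary PU) in ME.
set P := spectralmx M in ME PU; set sp := spectral_diag M in ME.
have /unitarymxP PP := PU.
pose Q := P ^t*; pose u k := col k Q.
have uE k : (u k) ^t* = row k P by apply/matrixP => i j; rewrite !mxE conjCK.
have diagE : P *m M *m Q = diag_mx sp.
  by rewrite ME !mulmxA PP mul1mx -mulmxA PP mulmx1.
have sp_ge0 k : 0 <= sp 0 k.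
  have := M_ge0 (u k); rewrite uE -row_mul /mxtrace big_ord1 mxE.
  rewrite (_ : \sum_j _ = (P *m M *m Q) k k); first by rewrite diagE mxE eqxx.
  by rewrite [RHS]mxE; apply: eq_bigr => j _; congr (_ * _); rewrite [LHS]mxE.
have Su k : csphere (u k).
  apply/csphereE; have := congr1 (fun A : 'M_n => A k k) PP; rewrite !mxE eqxx.
  by apply: etrans; apply: eq_bigr => j _; rewrite !mxE norm_conjC normCK.
have spE k : (complex.Re (sp 0 k))%:C = sp 0 k by rewrite RRe_real// ger0_real.
have MuE : M = \sum_k (complex.Re (sp 0 k))%:C *: outer (u k).
  rewrite ME; apply/matrixP => i j; rewrite !summxE -mulmxA mxE.
  apply: eq_bigr => k _; rewrite spE mul_diag_mx !mxE big_ord1 !mxE conjCK.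
  by rewrite mulrCA.
exists (fun k => complex.Re (sp 0 k)), u; split => //.
  by move=> k; rewrite -lecR spE.
apply: (@complexI R); rewrite rmorph1 -trM MuE rmorph_sum [RHS]raddf_sum.
apply: eq_bigr => k _; rewrite /= mxtraceZ.
by have [_ _ ->] := outer_density (Su k); rewrite mulr1.
Qed.

End States.

(** * DPS hierarchy and quantum Wasserstein distance *)

Section Programs.
Local Open Scope complex_scope.
Local Open Scope sesquilinear_scope.
Variables (R : realType) (n : nat).
Hypothesis n_gt0 : (1 <= n)%N.
Local Notation C := R[i].
Local Notation conj x := (map_mx Num.conj x).

Lemma Re_mxtrace_extrapolation m (M v L : 'M[C]_m) (e : R) :
  complex.Re (\tr (((1 + e)%:C *: M - e%:C *: v) *m L)) =
  (1 + e) * complex.Re (\tr (M *m L)) - e * complex.Re (\tr (v *m L)).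
Proof.
rewrite mulmxBl -!scalemxAl mxtraceD raddfN /= !mxtraceZ raddfB /=.
by rewrite ![_%:C * _]mulrC !Re_mulr_complex ![_ * complex.Re _]mulrC.
Qed.

(** Along a separable decomposition, the objective is the total weight minus the weighted values of
    the constrained form. *)
Lemma DPS_attained (rho : 'M[C]_(n * n)) :
  relint (SEP R n) rho ->
  sup_attained
    [set L : 'M[C]_(n * n) | herm_tensor L /\
      forall x y : 'cV[C]_n, csphere x -> csphere y ->
        0 <= 1 - tensor_qform L x (conj x) y (conj y)]
    (fun L => complex.Re (\tr (rho *m L))) /\
  forall t : nat, (2 <= t)%N ->
  sup_attained
    [set L : 'M[C]_(n * n) | herm_tensor L /\
      bisphere_sos t
        (1 - tensor_qform (map_mx (@mpolyC _ _) L)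
               (px R n) (pxb R n) (py R n) (pyb R n))]
    (fun L => complex.Re (\tr (rho *m L))).
Proof.
move=> rho_int; pose val (L : 'M[C]_(n * n)) x y := 1 - tensor_qform L x (conj x) y (conj y).
have trE (I : finType) (w : I -> R) (x y : I -> 'cV[C]_n) (L : 'M[C]_(n * n)) :
    complex.Re (\tr ((\sum_l (w l)%:C *: (outer (x l) *t outer (y l))) *m L)) =
    \sum_l w l - \sum_l w l * complex.Re (val L (x l) (y l)).
  rewrite -sumrB mulmx_suml (raddf_sum (@mxtrace C _)) (raddf_sum (@complex.Re R)).
  apply: eq_bigr => l _ /=.
  rewrite -scalemxAl mxtraceZ mxtrace_outer_tens_mul mulrC Re_mulr_complex.
  by rewrite /val raddfB /=; ring.
have [I [w [x0 [y0 [w0 Sx0 Sy0 rhoE]]]]] := SEP_sep_sum (relint_sub rho_int).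
apply: (@bisphere_program_attained R n n_gt0 _ (@herm_tensor R n)
  (fun L => 1 - tensor_qform (map_mx (@mpolyC _ _) L) (px R n) (pxb R n) (py R n) (pyb R n))
  (fun L => complex.Re (\tr (rho *m L))) val _ _ _ _ (\sum_l w l) I w x0 y0 Sx0 Sy0).
- move=> L _; apply: msizeB_leq; first by rewrite msize1.
  by apply: msize_tensor_qform => j; rewrite ?msize_cvar ?msize_cvarb.
- move=> L z; rewrite mevalB meval1 [X in 1 - X](tensor_qform_map (meval _)).
  rewrite !map_cvar !map_cvarb; congr (1 - tensor_qform _ _ _ _ _).
  by apply/matrixP => i j; rewrite !mxE; exact: mevalC.
- by move=> L x y hL; rewrite /val raddfB /= tensor_qform_real// subrr.
- move=> L1 L2 L3 c h1 h2 h3; exists (L1 + c%:C *: (L2 - L3)).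
    exact: herm_tensor_affine.
  move=> x y; rewrite /val tensor_qformE qform_affine -!tensor_qformE.
  move: (tensor_qform L1 _ _ _ _) (tensor_qform L2 _ _ _ _) (tensor_qform L3 _ _ _ _).
  by clear=> p1 p2 p3; ring.
- by move=> L _; rewrite rhoE trE.
(* Since (1 + e) rho - e (outer x (x) outer y) is separable, its pairing with a feasible [L] is at
   most its total weight; solving for the value at (x, y) gives the constant below. *)
- move=> x y c Sx Sy; have [e e0 Se] := relint_extend rho_int (SEP_outer x y).
  have [J [w' [x' [y' [w0' Sx' Sy' sE]]]]] := SEP_sep_sum Se.
  exists ((\sum_l w' l + e - (1 + e) * c) / e) => L hL L_ge0 cL.
  rewrite ler_pdivlMr//.
  have : complex.Re (\tr (((1 + e)%:C *: rho - e%:C *: (outer x *t outer y)) *m L)) <=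
      \sum_l w' l.
    rewrite sE trE gerBl; apply: sumr_ge0 => l _; apply: mulr_ge0 => //.
    by have := L_ge0 _ _ (Sx' l) (Sy' l); rewrite lecE => /andP[].
  rewrite Re_mxtrace_extrapolation mxtrace_outer_tens_mul.
  rewrite /val raddfB /=; nra.
(* For [L = 0] the constrained polynomial is 1, a square. *)
- move=> t t2; exists 0.
    exists 0%N, (fun=> 0), (fun=> 0); split=> [[]|[]|] //.
    by rewrite big_ord0.
  rewrite (_ : _ - _ = map_mpoly (real_complex R) 1).
    rewrite mpoly_Re_map -[1](expr1n _ 2); apply: sos_plus_ideal_sqr.
    by rewrite msize1.
  rewrite map_mx0 /tensor_qform mulmx0 mul0mx mxtrace0 subr0.
  by rewrite -mpolyC1 map_mpolyC.
Qed.

(** Adding s I to one multiplier and subtracting it from the other changes neither the objective nor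
    the values on X, so feasible pairs at a given level are unbounded; the bounds below concern
    values only. *)
Lemma wasserstein_attained (tau omega : 'M[C]_n) :
  relint (density R n) tau -> relint (density R n) omega ->
  sup_attained
    [set LG : 'M[C]_n * 'M[C]_n | [/\ herm LG.1, herm LG.2 &
      forall x y : 'cV[C]_n, csphere x -> csphere y ->
        0 <= wasserstein_cost x (conj x) y (conj y)
             - qform LG.1 x (conj x) - qform LG.2 y (conj y)]]
    (fun LG => complex.Re (\tr (tau *m LG.1 + omega *m LG.2))) /\
  forall t : nat, (2 <= t)%N ->
  sup_attained
    [set LG : 'M[C]_n * 'M[C]_n | [/\ herm LG.1, herm LG.2 &
      bisphere_sos t
        (wasserstein_cost (px R n) (pxb R n) (py R n) (pyb R n)
         - qform (map_mx (@mpolyC _ _) LG.1) (px R n) (pxb R n)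
         - qform (map_mx (@mpolyC _ _) LG.2) (py R n) (pyb R n))]]
    (fun LG => complex.Re (\tr (tau *m LG.1 + omega *m LG.2))).
Proof.
move=> tau_int omega_int.
pose cost (x y : 'cV[C]_n) := wasserstein_cost x (conj x) y (conj y).
pose val (LG : 'M[C]_n * 'M[C]_n) x y :=
  cost x y - qform LG.1 x (conj x) - qform LG.2 y (conj y).
have Re_val LG x y : complex.Re (val LG x y) = complex.Re (cost x y)
    - complex.Re (qform LG.1 x (conj x)) - complex.Re (qform LG.2 y (conj y)).
  by rewrite /val raddfB /= raddfB.
pose H := [set LG : 'M[C]_n * 'M[C]_n | herm LG.1 /\ herm LG.2].
pose P (LG : 'M[C]_n * 'M[C]_n) := wasserstein_cost (px R n) (pxb R n) (py R n) (pyb R n)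
  - qform (map_mx (@mpolyC _ _) LG.1) (px R n) (pxb R n)
  - qform (map_mx (@mpolyC _ _) LG.2) (py R n) (pyb R n).
have PE LG z : (P LG).@[fun i => (z i)%:C] = val LG (cpoint 0 1 z) (cpoint 2 3 z).
  have mapC (L : 'M[C]_n) : map_mx (meval (fun i => (z i)%:C)) (map_mx (@mpolyC _ _) L) = L.
    by apply/matrixP => i j; rewrite !mxE; exact: mevalC.
  rewrite /P mevalB mevalB; congr (_ - _ - _).
  - by rewrite [LHS](wasserstein_cost_map (meval _)) !map_cvar !map_cvarb.
  - by rewrite [LHS](qform_map (meval _)) map_cvar map_cvarb mapC.
  - by rewrite [LHS](qform_map (meval _)) map_cvar map_cvarb mapC.
have P_size LG : (msize (P LG) <= 5)%N.
  have q (x xb : 'cV[{mpoly C[4 * n]}]_n) (L : 'M[C]_n) :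
      (forall j, msize (x j 0%R) <= 2)%N -> (forall j, msize (xb j 0%R) <= 2)%N ->
      (msize (qform (map_mx (@mpolyC _ _) L) x xb) <= 5)%N.
    by move=> x1 xb1; apply: leq_trans (@msize_qform _ _ _ 1 1 _ _ _ x1 xb1) _.
  apply: msizeB_leq; first apply: msizeB_leq.
  - by apply: msize_wasserstein_cost => j; rewrite ?msize_cvar ?msize_cvarb.
  - by apply: q => j; rewrite ?msize_cvar ?msize_cvarb.
  - by apply: q => j; rewrite ?msize_cvar ?msize_cvarb.
(* The product of the two spectral measures is a coupling with marginals [alpha] and [beta];
   integrating the constrained polynomial against it gives the objective. *)
have pairE (alpha beta : 'M[C]_n) : density R n alpha -> density R n beta ->
  exists (g0 : R) (w : 'I_n * 'I_n -> R) x0 y0,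
    [/\ forall l, 0 <= w l, forall l, csphere (x0 l), forall l, csphere (y0 l) &
     forall LG, complex.Re (\tr (alpha *m LG.1 + beta *m LG.2)) =
       g0 - \sum_l w l * complex.Re (val LG (x0 l) (y0 l))].
  move=> /density_spectral[d [u [d0 d1 Su alphaE]]] /density_spectral[e [v [e0 e1 Sv betaE]]].
  exists (\sum_(l : 'I_n * 'I_n) d l.1 * e l.2 * complex.Re (cost (u l.1) (v l.2))).
  exists (fun l => d l.1 * e l.2), (fun l => u l.1), (fun l => v l.2).
  split=> [l|l|l|LG] //; first exact: mulr_ge0.
  have trE (f : 'I_n -> R) (y : 'I_n -> 'cV[C]_n) (L : 'M[C]_n) :
      complex.Re (\tr ((\sum_k (f k)%:C *: outer (y k)) *m L)) =
      \sum_k f k * complex.Re (qform L (y k) (conj (y k))).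
    rewrite mulmx_suml (raddf_sum (@mxtrace C _)) (raddf_sum (@complex.Re R)).
    apply: eq_bigr => k _ /=.
    by rewrite -scalemxAl mxtraceZ mxtrace_outer_mul mulrC Re_mulr_complex mulrC.
  rewrite -sumrB mxtraceD raddfD /= alphaE betaE !trE.
  (* Each marginal sum is multiplied by the total mass 1 of the other measure to become a double
     sum. *)
  rewrite -[X in X + _]mulr1 -{1}e1 -[X in _ + X]mul1r -{1}d1 !big_distrlr /=.
  rewrite -big_split -(pair_bigA _ (fun k j => d k * e j * complex.Re (cost (u k) (v j))
    - d k * e j * complex.Re (val LG (u k) (v j)))) /=.
  apply: eq_bigr => k _; rewrite -big_split; apply: eq_bigr => j _ /=.
  rewrite Re_val; move: (complex.Re (cost _ _)) => p.
  move: (complex.Re (qform _ (u k) _)) (complex.Re (qform _ (v j) _)) (d k) (e j) => q r dk ej.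
  by clear; ring.
have tau_d := relint_sub tau_int; have omega_d := relint_sub omega_int.
have [g0 [w [x0 [y0 [w0 Sx0 Sy0 gE]]]]] := pairE _ _ tau_d omega_d.
(* Weak duality: the objective for any two density matrices is at most the cost of their product
   coupling. *)
have nonneg_le (alpha beta : 'M[C]_n) : density R n alpha -> density R n beta ->
    exists B : R, forall LG, H LG ->
      (forall x y, csphere x -> csphere y -> 0 <= val LG x y) ->
      complex.Re (\tr (alpha *m LG.1)) + complex.Re (\tr (beta *m LG.2)) <= B.
  move=> da db; have [B [w' [x' [y' [w0' Sx' Sy' E]]]]] := pairE _ _ da db.
  exists B => LG _ LG_ge0; rewrite -raddfD /= -mxtraceD E gerBl.
  apply: sumr_ge0 => l _; apply: mulr_ge0 => //.
  by have := LG_ge0 _ _ (Sx' l) (Sy' l); rewrite lecE => /andP[].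
have [nonneg sos] : sup_attained
    [set LG | H LG /\ forall x y, csphere x -> csphere y -> 0 <= val LG x y]
    (fun LG => complex.Re (\tr (tau *m LG.1 + omega *m LG.2))) /\
  forall t : nat, (2 <= t)%N -> sup_attained [set LG | H LG /\ bisphere_sos t (P LG)]
    (fun LG => complex.Re (\tr (tau *m LG.1 + omega *m LG.2))).
  apply: (@bisphere_program_attained R n n_gt0 _ H P
    (fun LG => complex.Re (\tr (tau *m LG.1 + omega *m LG.2))) val _ PE _ _
    g0 _ w x0 y0 Sx0 Sy0).
  - by move=> LG _; exact: P_size.
  - move=> LG x y [h1 h2]; rewrite /val !raddfB /= wasserstein_cost_real.
    by rewrite !qform_real// !subr0.
  - move=> v1 v2 v3 c [h1 h1'] [h2 h2'] [h3 h3'].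
    exists (v1.1 + c%:C *: (v2.1 - v3.1), v1.2 + c%:C *: (v2.2 - v3.2)).
      by split; exact: herm_affine.
    move=> x y; rewrite /val /= !qform_affine.
    move: (cost x y) (qform v1.1 _ _) (qform v2.1 _ _) (qform v3.1 _ _) => k p1 p2 p3.
    by move: (qform v1.2 _ _) (qform v2.2 _ _) (qform v3.2 _ _) => q1 q2 q3; clear; ring.
  - by move=> LG _; exact: gE.
  - move=> x y c Sx Sy.
    (* One state is extrapolated at a time. With a + b >= c, weak duality for (extrapolated tau,
       omega) bounds a - qa by (B1 - c) / e, and symmetrically for b - qb; the value is cost - (a +
       b) + (a - qa) + (b - qb). *)
    have [e e0 Se] := relint_extend tau_int (outer_density Sx).
    have [f f0 Sf] := relint_extend omega_int (outer_density Sy).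
    have [B1 B1P] := nonneg_le _ _ Se omega_d.
    have [B2 B2P] := nonneg_le _ _ tau_d Sf.
    exists (complex.Re (cost x y) - c + (B1 - c) / e + (B2 - c) / f) => LG hLG LG_ge0.
    have := B1P LG hLG LG_ge0; have := B2P LG hLG LG_ge0.
    rewrite !Re_mxtrace_extrapolation !mxtrace_outer_mul mxtraceD raddfD /=.
    rewrite Re_val.
    set a := complex.Re (\tr (tau *m _)); set b := complex.Re (\tr (omega *m _)).
    set qa := complex.Re (qform _ x _); set qb := complex.Re (qform _ y _) => le2 le1 cab.
    have ha : a - qa <= (B1 - c) / e by rewrite ler_pdivlMr//; nra.
    have hb : b - qb <= (B2 - c) / f by rewrite ler_pdivlMr//; nra.
    move: (complex.Re (cost x y)) => k; clearbody a b qa qb.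
    by clear -ha hb cab; lra.
  (* Both multipliers are taken to be -(c/2) I: on X this adds exactly c to the cost, which makes it
     a truncated sum of squares modulo the ideal. *)
  - move=> t t2; have [c Qc] : exists c : R, sos_plus_ideal (sph R (@bisphere_blk n)) (2 * t)
        (c%:MP + mpoly_Re (P (0, 0))).
      apply: sos_plus_ideal_order_unit; apply: leq_trans (msize_mpoly_Re _) _.
      by apply: leq_trans (P_size _) _; lia.
    have q0 (x : 'cV[C]_n) : qform 0 x (conj x) = 0.
      by rewrite /qform mulmx0 mul0mx mxtrace0.
    have [L [hL qL]] : exists L : 'M[C]_n, herm L /\
        forall x, csphere x -> qform L x (conj x) = (- (c / 2))%:C.
      exists (0 + (- (c / 2))%:C *: (1%:M - 0)); split.
        exact: herm_affine (herm0 R n) (hermitian1mx_subproof n) (herm0 R n).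
      move=> x Sx; rewrite (qform_affine 0 1%:M 0) !q0 qform1_sphere//.
      by rewrite add0r subr0 mulr1.
    (* As polynomials the two sides differ by multiples of the sphere equations; they agree on X, so
       the difference is in the truncated ideal. *)
    exists (L, L) => //; rewrite -(subrK (c%:MP + mpoly_Re (P (0, 0))) (mpoly_Re _)).
    apply: sos_plus_idealD => //; apply/sos_plus_ideal_ideal.
    have Pt LG : (msize (mpoly_Re (P LG)) <= (2 * t).+1)%N.
      by apply: leq_trans (msize_mpoly_Re _) _; apply: leq_trans (P_size _) _; lia.
    apply: (truncated_nullstellensatz (bisphere_hdK n_gt0)).
      by apply: msizeB_leq => //; apply: msizeD_leq => //; exact: msizeC_leq.
    move=> z /on_bisphereP[Sx Sy]; rewrite mevalB mevalD mevalC.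
    have E LG := etrans (mpoly_ReE (P LG) z)
      (etrans (congr1 (@complex.Re R) (PE LG z)) (Re_val LG _ _)).
    apply: etrans (congr2 (fun p q => p - (c + q)) (E (L, L)) (E (0, 0))) _.
    rewrite /= (qL _ Sx) (qL _ Sy) !q0 /=.
    by move: (complex.Re _) => k; clear; lra.
split=> [|t t2].
  by apply: sup_attained_eq nonneg => // LG; split=> [[[]]|[]].
by apply: sup_attained_eq (sos t t2) => // LG; split=> [[[]]|[]].
Qed.

End Programs.

Theorem corollary6p2 (R : realType) :
  (forall (n : nat) (rho : 'M[R[i]]_(n * n)),
    (1 <= n)%N -> herm_tensor rho -> relint (SEP R n) rho ->
    sup_attained
      [set L : 'M[R[i]]_(n * n) | herm_tensor L /\
        forall x y : 'cV[R[i]]_n, csphere x -> csphere y ->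
          0 <= 1 - tensor_qform L x (map_mx Num.conj x) y (map_mx Num.conj y)]
      (fun L => complex.Re (\tr (rho *m L))) /\
    forall t : nat, (2 <= t)%N ->
    sup_attained
      [set L : 'M[R[i]]_(n * n) | herm_tensor L /\
        bisphere_sos t
          (1 - tensor_qform (map_mx (@mpolyC _ _) L)
                 (px R n) (pxb R n) (py R n) (pyb R n))]
      (fun L => complex.Re (\tr (rho *m L))))
  /\
  (forall (n : nat) (tau omega : 'M[R[i]]_n),
    (1 <= n)%N -> relint (density R n) tau -> relint (density R n) omega ->
    sup_attained
      [set LG : 'M[R[i]]_n * 'M[R[i]]_n | [/\ herm LG.1, herm LG.2 &
        forall x y : 'cV[R[i]]_n, csphere x -> csphere y ->
          0 <= wasserstein_cost x (map_mx Num.conj x) y (map_mx Num.conj y)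
               - qform LG.1 x (map_mx Num.conj x) - qform LG.2 y (map_mx Num.conj y)]]
      (fun LG => complex.Re (\tr (tau *m LG.1 + omega *m LG.2))) /\
    forall t : nat, (2 <= t)%N ->
    sup_attained
      [set LG : 'M[R[i]]_n * 'M[R[i]]_n | [/\ herm LG.1, herm LG.2 &
        bisphere_sos t
          (wasserstein_cost (px R n) (pxb R n) (py R n) (pyb R n)
           - qform (map_mx (@mpolyC _ _) LG.1) (px R n) (pxb R n)
           - qform (map_mx (@mpolyC _ _) LG.2) (py R n) (pyb R n))]]
      (fun LG => complex.Re (\tr (tau *m LG.1 + omega *m LG.2))))
  /\
  (forall (a : nat) (dim : 'I_a -> nat) (A : multi_index dim -> R),
    (1 <= a)%N -> (forall l, (2 <= dim l)%N) ->
    sup_attained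
      [set lambda : R | forall x : forall l : 'I_a, 'cV[R]_(dim l),
        (forall l, rsphere (x l)) -> 0 <= tensor_form A x - lambda]
      (fun lambda => lambda) /\
    forall t : nat, (maxn 1 (uphalf (deg (tensor_poly A))) <= t)%N ->
    sup_attained
      [set lambda : R |
        sos_plus_ideal (multisphere_polys dim) (2 * t)
          (tensor_poly A - lambda%:MP)]
      (fun lambda => lambda)).
Proof.
split; [|split].
- by move=> n rho n_gt0 _; exact: DPS_attained.
- by move=> n tau omega n_gt0; exact: wasserstein_attained.
- by move=> a dim A _ dim_ge2; exact: rank_one_attained.
Qed.
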